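(* Suppose $p,q\notin I$. Let $\nu=\sum_{i\in I^+}\nu_i i+\sum_{i\in I^-}\nu_i i\in{}^\theta\mathbb{N}I$, let $\tilde\nu=\sum_{i\in I^+}\nu_i i\in\mathbb{N}I^+$, and let $\mathbf{R}^+_{\tilde\nu}$ be the KLR algebra associated to $\tilde\nu$. Then $\mathfrak{W}_\nu$ and $\mathbf{R}^+_{\tilde\nu}$ are Morita equivalent.
   Context: **Setting.** $\mathbf{k}$ is a field with $\operatorname{char}\mathbf{k}\neq 2$; $p,q\in\mathbf{k}^\times$ are fixed with $p\neq\pm1$, $p$ not a power of $q$ and $q$ not a power of $p$ ($p$ may be a root of unity). $\mathbb{Z}\rtimes\mathbb{Z}_2$ acts on $\mathbf{k}^\times$ by $(n,\varepsilon)\cdot\lambda=p^{2n}\lambda^{\varepsilon}$, $\varepsilon\in\{\pm1\}$. $I=I_\lambda=\{p^{2n}\lambda^{\pm1}\mid n\in\mathbb{Z}\}$ is an orbit with $\pm1\notin I$; $I^+=\{p^{2n}\lambda\mid n\in\mathbb{Z}\}$, $I^-=\{p^{2n}\lambda^{-1}\mid n\in\mathbb{Z}\}$, and it is assumed that $I=I^+\sqcup I^-$ is a disjoint union. $\Gamma_I$ is the quiver with vertex set $I$ and one arrow $p^2i\to i$ for every $i\in I$. ${}^\theta\mathbb{N}I$ is the set of formal sums $\nu=\sum_{i\in I}\nu_i i$ with finite support, $\nu_i\in\mathbb{Z}_{\ge0}$ and $\nu_i=\nu_{i^{-1}}$; $|\nu|=\sum_i\nu_i=2m$. ${}^\theta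 I^\nu=\{\mathbf{i}\in I^m\mid\sum_k i_k+\sum_k i_k^{-1}=\nu\}$ (formal sums). $\mathbb{N}I^+$ is the set of finitely supported formal sums $\tilde\nu=\sum_{i\in I^+}\tilde\nu_i i$, $\tilde\nu_i\in\mathbb{Z}_{\ge0}$; if $\sum\tilde\nu_i=m$ then $I^{\tilde\nu}=\{\mathbf{i}\in I^m\mid\sum_ki_k=\tilde\nu\}$. **Arrow notation.** $i\to j$ (equivalently $j\leftarrow i$): there is an arrow from $i$ to $j$ and none from $j$ to $i$; $i\leftrightarrow j$: arrows in both directions; $i\nleftrightarrow j$: $i\ne j$ and no arrows between them. **KLR algebra.** $\mathbf{R}_{\tilde\nu}=\mathbf{R}^+_{\tilde\nu}$ is the $\mathbf{k}$-algebra generated by $x_1,\dots,x_m$, $\sigma_1,\dots,\sigma_{m-1}$ and $\mathbf{e}(\mathbf{i})$, $\mathbf{i}\in I^{\tilde\nu}$, with relations ($s_k$ swaps entries $k,k+1$): (1) $\mathbf{e}(\mathbf{i})\mathbf{e}(\mathbf{j})=\delta_{\mathbf{ij}}\mathbf{e}(\mathbf{i})$, $\sigma_k\mathbf{e}(\mathbf{i})=\mathbf{e}(s_k\mathbf{i})\sigma_k$, $x_l\mathbf{e}(\mathbf{i})=\mathbf{e}(\mathbf{i})x_l$, $\sum_{\mathbf{i}}\mathbf{e}(\mathbf{i})=1$. (2) The $x_l$ commute. (3) $\sigma_k^2\mathbf{e}(\mathbf{i})$ equals $\mathbf{e}(\mathbf{i})$ if $i_k\nleftrightarrow i_{k+1}$;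 $(x_{k+1}-x_k)\mathbf{e}(\mathbf{i})$ if $i_k\leftarrow i_{k+1}$; $(x_k-x_{k+1})\mathbf{e}(\mathbf{i})$ if $i_k\to i_{k+1}$; $(x_{k+1}-x_k)(x_k-x_{k+1})\mathbf{e}(\mathbf{i})$ if $i_k\leftrightarrow i_{k+1}$; $0$ if $i_k=i_{k+1}$. $\sigma_j\sigma_k=\sigma_k\sigma_j$ for $|j-k|>1$. $(\sigma_{k+1}\sigma_k\sigma_{k+1}-\sigma_k\sigma_{k+1}\sigma_k)\mathbf{e}(\mathbf{i})$ equals, when $i_k=i_{k+2}$: $\mathbf{e}(\mathbf{i})$ if $i_k\to i_{k+1}$; $-\mathbf{e}(\mathbf{i})$ if $i_k\leftarrow i_{k+1}$; $(2x_{k+1}-x_{k+2}-x_k)\mathbf{e}(\mathbf{i})$ if $i_k\leftrightarrow i_{k+1}$; and $0$ in all other cases. (4) $(\sigma_kx_l-x_{s_k(l)}\sigma_k)\mathbf{e}(\mathbf{i})$ equals $-\mathbf{e}(\mathbf{i})$ if $l=k$, $i_k=i_{k+1}$; $\mathbf{e}(\mathbf{i})$ if $l=k+1$, $i_k=i_{k+1}$; $0$ otherwise. $\mathbf{R}_0=\mathbf{k}$. **VV algebra.** For $|\nu|=2m$, $\mathfrak{W}_\nu$ is the $\mathbf{k}$-algebra generated by $x_1,\dots,x_m$, $\sigma_1,\dots,\sigma_{m-1}$, $\pi$, and $\mathbf{e}(\mathbf{i})$, $\mathbf{i}\in{}^\theta I^\nu$, with relations (1)–(4) (now for $\mathbf{i}\in{}^\theta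 I^\nu$) together with: (5) $\pi\mathbf{e}(i_1,\dots,i_m)=\mathbf{e}(i_1^{-1},i_2,\dots,i_m)\pi$. (6) $\pi^2\mathbf{e}(\mathbf{i})$ equals $x_1\mathbf{e}(\mathbf{i})$ if $i_1=q$; $-x_1\mathbf{e}(\mathbf{i})$ if $i_1=q^{-1}$; $\mathbf{e}(\mathbf{i})$ otherwise (here always the last case, as $q\notin I$). (7) $\pi x_1=-x_1\pi$; $\pi x_l=x_l\pi$ for $l>1$. (8) $(\sigma_1\pi)^2\mathbf{e}(\mathbf{i})-(\pi\sigma_1)^2\mathbf{e}(\mathbf{i})$ equals $\sigma_1\mathbf{e}(\mathbf{i})$ if $i_1^{-1}=i_2=q^{-1}$; $-\sigma_1\mathbf{e}(\mathbf{i})$ if $i_1^{-1}=i_2=q$; $0$ otherwise (here always $0$). $\pi\sigma_k=\sigma_k\pi$ for $k\ne1$. $\mathfrak{W}_0=\mathbf{k}$. *)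

(* Defs.v *)
From HB Require Import structures.
From mathcomp Require Import all_boot perm all_algebra.
From mathcomp Require Import finmap multiset.
From mathcomp Require Import boolp classical_sets.

Set Implicit Arguments.
Unset Strict Implicit.
Unset Printing Implicit Defensive.

Import GRing.Theory.
Local Open Scope ring_scope.
Local Open Scope quotient_scope.

(* A k-algebra is a ring with a central ring morphism from k.  The library's
   [algType] is not used because it only contains nonzero rings, and an algebra
   given by a presentation is not known in advance to be nonzero. *)
Record kalg (F : fieldType) := KAlg {
  kalg_ring :> pzRingType;
  kscal : {rmorphism F -> kalg_ring};
  kscal_central : forall c (a : kalg_ring), kscal c * a = a * kscal c }.
Arguments kscal {F} k : rename.

Definition kalg_base (F : fieldType) : kalg F :=
  @KAlg F F idfun (fun c a => mulrC c a).

(* [congr rel] is the smallest congruence on formal noncommutative polynomial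
   expressions which contains [rel] and for which the quotient is a k-algebra;
   the quotient is the algebra with generators T and relations [rel]. *)
Section Presentation.
Variables (F : fieldType) (T : Type).

Inductive aexpr : Type :=
| TVar of T
| TCst of F
| TAdd of aexpr & aexpr
| TMul of aexpr & aexpr.

Definition TOpp (t : aexpr) : aexpr := TMul (TCst (-1)) t.

Variable rel : aexpr -> aexpr -> Prop.

Inductive congr : aexpr -> aexpr -> Prop :=
| congr_rel s t : rel s t -> congr s t
| congr_refl s : congr s s
| congr_sym s t : congr s t -> congr t s
| congr_trans s t u : congr s t -> congr t u -> congr s u
| congr_add s s' t t' :
    congr s s' -> congr t t' -> congr (TAdd s t) (TAdd s' t')
| congr_mul s s' t t' :
    congr s s' -> congr t t' -> congr (TMul s t) (TMul s' t')
| congr_addA s t u : congr (TAdd s (TAdd t u)) (TAdd (TAdd s t) u)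
| congr_addC s t : congr (TAdd s t) (TAdd t s)
| congr_add0 s : congr (TAdd (TCst 0) s) s
| congr_addN s : congr (TAdd (TOpp s) s) (TCst 0)
| congr_mulA s t u : congr (TMul s (TMul t u)) (TMul (TMul s t) u)
| congr_mul1 s : congr (TMul (TCst 1) s) s
| congr_mulDl s t u : congr (TMul (TAdd s t) u) (TAdd (TMul s u) (TMul t u))
| congr_mulDr s t u : congr (TMul s (TAdd t u)) (TAdd (TMul s t) (TMul s u))
| congr_cstD a b : congr (TCst (a + b)) (TAdd (TCst a) (TCst b))
| congr_cstM a b : congr (TCst (a * b)) (TMul (TCst a) (TCst b))
| congr_cstC a s : congr (TMul (TCst a) s) (TMul s (TCst a)).

HB.instance Definition _ := gen_eqMixin aexpr.
HB.instance Definition _ := gen_choiceMixin aexpr.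

Definition congrb (s t : aexpr) : bool := `[< congr s t >].

Lemma congrb_refl : reflexive congrb.
Proof. by move=> s; apply/asboolP; exact: congr_refl. Qed.

Lemma congrb_sym : symmetric congrb.
Proof.
by move=> s t; apply/asboolP/asboolP => st; exact: congr_sym.
Qed.

Lemma congrb_trans : transitive congrb.
Proof.
move=> t s u /asboolP st /asboolP tu; apply/asboolP.
exact: congr_trans st tu.
Qed.

Canonical congr_equiv := EquivRel congrb congrb_refl congrb_sym congrb_trans.

Definition pres := {eq_quot congr_equiv}.
HB.instance Definition _ := Choice.on pres.

Definition cls (t : aexpr) : pres := \pi_pres t.

Lemma clsP s t : reflect (cls s = cls t) `[< congr s t >].
Proof. by apply: (iffP idP) => [st|/eqmodP//]; apply/eqmodP. Qed.

Lemma cls_eq s t : congr s t -> cls s = cls t.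
Proof. by move=> st; apply/clsP/asboolP. Qed.

Lemma cls_repr (a : pres) : cls (repr a) = a.
Proof. exact: reprK. Qed.

Lemma repr_cls t : congr (repr (cls t)) t.
Proof. by apply/asboolP/clsP; rewrite cls_repr. Qed.

Definition pres_add (a b : pres) := cls (TAdd (repr a) (repr b)).
Definition pres_mul (a b : pres) := cls (TMul (repr a) (repr b)).
Definition pres_opp (a : pres) := cls (TOpp (repr a)).
Definition pres_cst (c : F) := cls (TCst c).

Lemma cls_add s t : pres_add (cls s) (cls t) = cls (TAdd s t).
Proof. by apply: cls_eq; apply: congr_add; exact: repr_cls. Qed.

Lemma cls_mul s t : pres_mul (cls s) (cls t) = cls (TMul s t).
Proof. by apply: cls_eq; apply: congr_mul; exact: repr_cls. Qed.

Lemma cls_opp t : pres_opp (cls t) = cls (TOpp t).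
Proof.
by apply: cls_eq; apply: congr_mul; [exact: congr_refl|exact: repr_cls].
Qed.

Lemma cls_ind (P : pres -> Prop) : (forall t, P (cls t)) -> forall a, P a.
Proof. by move=> Pcls a; rewrite -[a]cls_repr. Qed.

Lemma pres_addA : associative pres_add.
Proof.
elim/cls_ind=> s; elim/cls_ind=> t; elim/cls_ind=> u.
by rewrite !cls_add; apply: cls_eq; exact: congr_addA.
Qed.

Lemma pres_addC : commutative pres_add.
Proof.
elim/cls_ind=> s; elim/cls_ind=> t.
by rewrite !cls_add; apply: cls_eq; exact: congr_addC.
Qed.

Lemma pres_add0 : left_id (pres_cst 0) pres_add.
Proof.
by elim/cls_ind=> s; rewrite cls_add; apply: cls_eq; exact: congr_add0.
Qed.

Lemma pres_mulA : associative pres_mul.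
Proof.
elim/cls_ind=> s; elim/cls_ind=> t; elim/cls_ind=> u.
by rewrite !cls_mul; apply: cls_eq; exact: congr_mulA.
Qed.

Lemma pres_mul1 : left_id (pres_cst 1) pres_mul.
Proof.
by elim/cls_ind=> s; rewrite cls_mul; apply: cls_eq; exact: congr_mul1.
Qed.

Lemma pres_cst_central c a : pres_mul (pres_cst c) a = pres_mul a (pres_cst c).
Proof.
by elim/cls_ind: a => s; rewrite !cls_mul; apply: cls_eq; exact: congr_cstC.
Qed.

Lemma pres_1mul : right_id (pres_cst 1) pres_mul.
Proof. by move=> a; rewrite -pres_cst_central pres_mul1. Qed.

Lemma pres_mulDl : left_distributive pres_mul pres_add.
Proof.
elim/cls_ind=> s; elim/cls_ind=> t; elim/cls_ind=> u.
by rewrite cls_add !cls_mul cls_add; apply: cls_eq; exact: congr_mulDl.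
Qed.

Lemma pres_mulDr : right_distributive pres_mul pres_add.
Proof.
elim/cls_ind=> s; elim/cls_ind=> t; elim/cls_ind=> u.
by rewrite cls_add !cls_mul cls_add; apply: cls_eq; exact: congr_mulDr.
Qed.

Lemma pres_cstD a b : pres_cst (a + b) = pres_add (pres_cst a) (pres_cst b).
Proof. by rewrite cls_add; apply: cls_eq; exact: congr_cstD. Qed.

Lemma pres_cstM a b : pres_cst (a * b) = pres_mul (pres_cst a) (pres_cst b).
Proof. by rewrite cls_mul; apply: cls_eq; exact: congr_cstM. Qed.

Lemma pres_addN : left_inverse (pres_cst 0) pres_opp pres_add.
Proof.
elim/cls_ind=> s; rewrite cls_opp cls_add.
by apply: cls_eq; exact: congr_addN.
Qed.

HB.instance Definition _ := GRing.isZmodule.Build pres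
  pres_addA pres_addC pres_add0 pres_addN.
HB.instance Definition _ := GRing.Zmodule_isPzRing.Build pres
  pres_mulA pres_mul1 pres_1mul pres_mulDl pres_mulDr.

Lemma pres_cst_zmod : zmod_morphism pres_cst.
Proof.
move=> a b; have <- : pres_cst (a - b) + pres_cst b = pres_cst a.
  by rewrite -[LHS]/(pres_add _ _) -pres_cstD subrK.
by rewrite addrK.
Qed.

Lemma pres_cst_monoid : monoid_morphism pres_cst.
Proof. by split=> // a b; exact: pres_cstM. Qed.

HB.instance Definition _ := GRing.isZmodMorphism.Build F pres pres_cst
  pres_cst_zmod.
HB.instance Definition _ := GRing.isMonoidMorphism.Build F pres pres_cst
  pres_cst_monoid.

Definition presented : kalg F := KAlg pres_cst_central.

Fixpoint teval (A : kalg F) (f : T -> A) (t : aexpr) : A :=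
  match t with
  | TVar x => f x
  | TCst c => kscal A c
  | TAdd s t => teval f s + teval f t
  | TMul s t => teval f s * teval f t
  end.

Lemma congr_teval (A : kalg F) (f : T -> A) :
  (forall s t, rel s t -> teval f s = teval f t) ->
  forall s t, congr s t -> teval f s = teval f t.
Proof.
move=> frel s t; elim=> //=.
- by move=> ? ? ? _ -> _ ->.
- by move=> ? ? ? ? _ -> _ ->.
- by move=> ? ? ? ? _ -> _ ->.
- by move=> *; rewrite addrA.
- by move=> *; rewrite addrC.
- by move=> ?; rewrite rmorph0 add0r.
- by move=> ?; rewrite rmorphN1 mulN1r addNr rmorph0.
- by move=> *; rewrite mulrA.
- by move=> ?; rewrite rmorph1 mul1r.
- by move=> *; rewrite mulrDl.
- by move=> *; rewrite mulrDr.
- by move=> *; rewrite rmorphD.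
- by move=> *; rewrite rmorphM.
- by move=> *; rewrite kscal_central.
Qed.

Lemma presented_univ (A : kalg F) (f : T -> A) :
  (forall s t, rel s t -> teval f s = teval f t) ->
  exists! phi : presented -> A,
    [/\ zmod_morphism phi, monoid_morphism phi,
        forall c, phi (kscal presented c) = kscal A c
      & forall x, phi (cls (TVar x)) = f x].
Proof.
move=> frel; pose phi (a : presented) := teval f (repr a).
have phiE t : phi (cls t) = teval f t by apply: congr_teval => //; exact: repr_cls.
have phiD a b : phi (a + b) = phi a + phi b.
  by move: a b; elim/cls_ind=> s; elim/cls_ind=> t;
     rewrite -[_ + _ in LHS]/(pres_add _ _) cls_add !phiE.
exists phi; split.
  split=> //.
  - by move=> a b; have := phiD (a - b) b; rewrite subrK => ->; rewrite addrK.
  - split; first by rewrite -[1]/(cls (TCst 1)) phiE /= rmorph1.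
    elim/cls_ind=> s; elim/cls_ind=> t.
    by rewrite -[_ * _ in LHS]/(pres_mul _ _) cls_mul !phiE.
  - by move=> c; exact: (phiE (TCst c)).
move=> psi [psiB [_ psiM] psiC psiX].
have psi0 : psi 0 = 0 by rewrite -[0](subrr 0) psiB subrr.
have psiN a : psi (- a) = - psi a by rewrite -sub0r psiB psi0 sub0r.
have psiD a b : psi (a + b) = psi a + psi b.
  by rewrite -[b in LHS]opprK psiB psiN opprK.
apply: funext; elim/cls_ind=> t; rewrite phiE.
elim: t => [x|c|s IHs t IHt|s IHs t IHt] /=.
- by rewrite psiX.
- by rewrite -psiC.
- by rewrite -cls_add psiD IHs IHt.
- by rewrite -cls_mul psiM IHs IHt.
Qed.

End Presentation.

Arguments TVar {F T}.
Arguments TCst {F T}.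

Declare Scope aexpr_scope.
Delimit Scope aexpr_scope with aexpr.
Bind Scope aexpr_scope with aexpr.
Notation "s + t" := (TAdd s t) : aexpr_scope.
Notation "s - t" := (TAdd s (TOpp t)) : aexpr_scope.
Notation "- t" := (TOpp t) : aexpr_scope.
Notation "s * t" := (TMul s t) : aexpr_scope.
Notation "0" := (TCst 0%R) : aexpr_scope.
Notation "1" := (TCst 1%R) : aexpr_scope.
Notation "2" := (TCst 2%:R) : aexpr_scope.
Notation "- 1" := (TOpp (TCst 1%R)) : aexpr_scope.

Section Quiver.
Variables (F : fieldType) (p lam : F).

Definition Iplus : set F := [set x | exists n : int, x = p ^ (2 * n) * lam]%classic.
Definition Iminus : set F :=
  [set x | exists n : int, x = p ^ (2 * n) * lam^-1]%classic.
Definition Iorbit : set F := (Iplus `|` Iminus)%classic.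

(* The arrows of the quiver are p^2 j -> j. *)
Definition arrow (i j : F) : bool := i == p ^+ 2 * j.
Definition arrow_to (i j : F) : bool := arrow i j && ~~ arrow j i.
Definition arrow_both (i j : F) : bool := arrow i j && arrow j i.

End Quiver.

(* Finite formal sums with coefficients in nat are multisets. *)
Section DimensionVectors.
Variable F : fieldType.
Local Open Scope mset_scope.

Definition thetaN (I : set F) (nu : {mset F}) : Prop :=
  (forall i, i \in nu -> I i) /\ (forall i, nu i = nu i^-1).

Definition mset_restrict (I : set F) (nu : {mset F}) : {mset F} :=
  [fsfun i in finsupp nu => if `[< I i >] then nu i else 0%N].

Variables (n : nat) (nu : {mset F}).

Definition klr_seq (i : n.-tuple F) : bool := seq_mset i == nu.

Definition theta_seq (i : n.-tuple F) : bool :=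
  msetD (seq_mset i) (seq_mset [seq x^-1 | x <- i]) == nu.

Definition klr_idx := {i : n.-tuple F | klr_seq i}.
Definition theta_idx := {i : n.-tuple F | theta_seq i}.

Lemma klr_seq_supp i : klr_seq i -> {subset i <= finsupp nu}.
Proof.
move=> /eqP <- x xi.
by rewrite mem_finsupp mset_seqE -lt0n -has_count has_pred1.
Qed.

Lemma theta_seq_supp i : theta_seq i -> {subset i <= finsupp nu}.
Proof.
move=> /eqP <- x xi.
rewrite mem_finsupp msetE2 mset_seqE -lt0n addn_gt0 -has_count has_pred1.
by rewrite xi.
Qed.

End DimensionVectors.

(* Both index sets are finite, as all entries lie in the support of nu; this is
   what gives a meaning to the sum of all idempotents. *)
Section IndexFinite.
Variables (F : fieldType) (n : nat) (nu : {mset F}%mset).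
Variable P : pred (n.-tuple F).
Hypothesis Psupp : forall i, P i -> {subset i <= finsupp nu}.

Definition idx_pack (i : {i | P i}) : n.-tuple (option (finsupp nu)) :=
  map_tuple insub (val i).

Definition idx_unpack (t : n.-tuple (option (finsupp nu))) : option {i | P i} :=
  insub (map_tuple (oapp val 0) t).

Lemma idx_packK : pcancel idx_pack idx_unpack.
Proof.
move=> i; rewrite /idx_unpack.
suff -> : map_tuple (oapp val 0) (idx_pack i) = val i by rewrite valK.
apply: val_inj => /=; rewrite -map_comp -[RHS]map_id; apply/eq_in_map => x xi /=.
by rewrite insubT ?(Psupp (valP i)).
Qed.
End IndexFinite.

Section IndexInstances.
Variables (F : fieldType) (n : nat) (nu : {mset F}%mset).

HB.instance Definition _ := Finite.copy (klr_idx n nu)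
  (pcan_type (idx_packK (@klr_seq_supp F n nu))).
HB.instance Definition _ := Finite.copy (theta_idx n nu)
  (pcan_type (idx_packK (@theta_seq_supp F n nu))).
End IndexInstances.

Section Relations.
Variables (F : fieldType) (p : F) (n : nat).

(* The positions k and k+1 exchanged by sigma_k; all indices start at 0. *)
Definition lo (k : 'I_n) : 'I_n.+1 := widen_ord (leqnSn n) k.
Definition hi (k : 'I_n) : 'I_n.+1 := lift ord0 k.

Definition swap_seq (k : 'I_n) (i : n.+1.-tuple F) : n.+1.-tuple F :=
  [tuple tnth i (tperm (lo k) (hi k) l) | l < n.+1].

Definition inv_first (i : n.+1.-tuple F) : n.+1.-tuple F :=
  [tuple if l == ord0 then (tnth i l)^-1 else tnth i l | l < n.+1].

Section KLR.
Variables (T : Type) (J : finType) (seq_of : J -> n.+1.-tuple F).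
Variables (x : 'I_n.+1 -> aexpr F T) (s : 'I_n -> aexpr F T) (e : J -> aexpr F T).
Local Open Scope aexpr_scope.

Definition quad_coef (k : 'I_n) (a b : F) : aexpr F T :=
  if a == b then 0
  else if arrow_both p a b then (x (hi k) - x (lo k)) * (x (lo k) - x (hi k))
  else if arrow_to p a b then x (lo k) - x (hi k)
  else if arrow_to p b a then x (hi k) - x (lo k)
  else 1.

Definition braid_coef (k k' : 'I_n) (a b c : F) : aexpr F T :=
  if a != c then 0
  else if arrow_to p a b then 1
  else if arrow_to p b a then - 1
  else if arrow_both p a b then 2 * x (hi k) - x (hi k') - x (lo k)
  else 0.

Definition sx_coef (k : 'I_n) (l : 'I_n.+1) (a b : F) : aexpr F T :=
  if (a == b) && (l == lo k) then - 1
  else if (a == b) && (l == hi k) then 1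
  else 0.

(* The index s_k i again belongs to J in both uses below; stating the relation
   for all j with underlying sequence s_k i avoids carrying the proof. *)
Inductive klr_rel : aexpr F T -> aexpr F T -> Prop :=
| klr_ee i j : klr_rel (e i * e j) (if i == j then e i else 0)
| klr_se k i j : seq_of j = swap_seq k (seq_of i) ->
    klr_rel (s k * e i) (e j * s k)
| klr_xe l i : klr_rel (x l * e i) (e i * x l)
| klr_sum1 : klr_rel (\big[@TAdd F T/0]_(i : J) e i) 1
| klr_xx l l' : klr_rel (x l * x l') (x l' * x l)
| klr_quad k i :
    klr_rel (s k * s k * e i)
      (quad_coef k (tnth (seq_of i) (lo k)) (tnth (seq_of i) (hi k)) * e i)
| klr_ss (j k : 'I_n) : (j.+1 < k)%N || (k.+1 < j)%N ->
    klr_rel (s j * s k) (s k * s j)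
| klr_braid (k k' : 'I_n) i : k' = k.+1 :> nat ->
    klr_rel ((s k' * s k * s k' - s k * s k' * s k) * e i)
      (braid_coef k k' (tnth (seq_of i) (lo k)) (tnth (seq_of i) (hi k))
         (tnth (seq_of i) (hi k')) * e i)
| klr_sx k l i :
    klr_rel ((s k * x l - x (tperm (lo k) (hi k) l) * s k) * e i)
      (sx_coef k l (tnth (seq_of i) (lo k)) (tnth (seq_of i) (hi k)) * e i).
End KLR.

Inductive klr_gen (nu : {mset F}%mset) : Type :=
| KX of 'I_n.+1
| KS of 'I_n
| KE of klr_idx n.+1 nu.

Definition klr_pos (nu : {mset F}%mset) : kalg F :=
  presented (klr_rel (val : klr_idx n.+1 nu -> n.+1.-tuple F)
    (fun l => TVar (KX nu l)) (fun k => TVar (KS nu k)) (fun i => TVar (KE i))).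

Variable q : F.

Inductive vv_gen (nu : {mset F}%mset) : Type :=
| VX of 'I_n.+1
| VS of 'I_n
| VE of theta_idx n.+1 nu
| VPi.

Section VV.
Variable nu : {mset F}%mset.
Local Open Scope aexpr_scope.
Let x l : aexpr F (vv_gen nu) := TVar (VX nu l).
Let s k : aexpr F (vv_gen nu) := TVar (VS nu k).
Let e i : aexpr F (vv_gen nu) := TVar (VE i).
Let pi : aexpr F (vv_gen nu) := TVar (VPi nu).

Definition pi_coef (a : F) : aexpr F (vv_gen nu) :=
  if a == q then x ord0 else if a == q^-1 then - x ord0 else 1.

Definition spi_coef (k : 'I_n) (a b : F) : aexpr F (vv_gen nu) :=
  if (a^-1 == b) && (b == q^-1) then s k
  else if (a^-1 == b) && (b == q) then - s k
  else 0.

Inductive vv_rel : aexpr F (vv_gen nu) -> aexpr F (vv_gen nu) -> Prop :=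
| vv_klr t u : klr_rel (val : theta_idx n.+1 nu -> n.+1.-tuple F) x s e t u -> vv_rel t u
| vv_pie (i j : theta_idx n.+1 nu) : val j = inv_first (val i) ->
    vv_rel (pi * e i) (e j * pi)
| vv_pipi i : vv_rel (pi * pi * e i) (pi_coef (tnth (val i) ord0) * e i)
| vv_pix0 : vv_rel (pi * x ord0) (- (x ord0 * pi))
| vv_pix l : l != ord0 -> vv_rel (pi * x l) (x l * pi)
| vv_spi (k : 'I_n) i : k = 0%N :> nat ->
    vv_rel (s k * pi * (s k * pi) * e i - pi * s k * (pi * s k) * e i)
      (spi_coef k (tnth (val i) (lo k)) (tnth (val i) (hi k)) * e i)
| vv_pis (k : 'I_n) : k != 0%N :> nat -> vv_rel (pi * s k) (s k * pi).
End VV.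

Definition vv_pos (nu : {mset F}%mset) : kalg F := presented (@vv_rel nu).

End Relations.

(* The number m of variables is |nu| for the KLR algebra and |nu|/2 for the VV
   algebra; both algebras are k by convention when m = 0. *)
Definition KLR (F : fieldType) (p : F) (nu : {mset F}%mset) : kalg F :=
  match size nu with
  | 0 => kalg_base F
  | n.+1 => klr_pos p n nu
  end.

Definition VV (F : fieldType) (p q : F) (nu : {mset F}%mset) : kalg F :=
  match (size nu)./2 with
  | 0 => kalg_base F
  | n.+1 => vv_pos p n q nu
  end.

Record mod_functor (F : fieldType) (A B : kalg F) := ModFunctor {
  fobj :> lmodType A -> lmodType B;
  fmap : forall M N : lmodType A, {linear M -> N} -> {linear fobj M -> fobj N};
  fmap_ext : forall (M N : lmodType A) (f g : {linear M -> N}),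
    f =1 g -> fmap f =1 fmap g;
  fmap_id : forall M : lmodType A, fmap (idfun : {linear M -> M}) =1 idfun;
  fmap_comp : forall (M N P : lmodType A)
    (g : {linear N -> P}) (f : {linear M -> N}),
    fmap (g \o f : {linear M -> P}) =1 fmap g \o fmap f;
  fmapD : forall (M N : lmodType A) (f g h : {linear M -> N}),
    (forall m, h m = f m + g m) ->
    forall m, fmap h m = fmap f m + fmap g m;
  fmapZ : forall (M N : lmodType A) (c : F) (f h : {linear M -> N}),
    (forall m, h m = kscal A c *: f m) ->
    forall m, fmap h m = kscal B c *: fmap f m }.

Definition comp_iso_id (F : fieldType) (A B : kalg F)
    (G : mod_functor B A) (H : mod_functor A B) : Prop :=
  exists eta : forall M : lmodType A, {linear G (H M) -> M},
    (forall M, bijective (eta M)) /\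
    (forall (M N : lmodType A) (f : {linear M -> N}),
       eta N \o fmap G (fmap H f) =1 f \o eta M).

Definition morita_equivalent (F : fieldType) (A B : kalg F) : Prop :=
  exists (H : mod_functor A B) (G : mod_functor B A),
    comp_iso_id G H /\ comp_iso_id H G.

(* Main.v *)
Require Import Defs.
From HB Require Import structures.
From mathcomp Require Import all_boot perm all_algebra.
From mathcomp Require Import finmap multiset.
From mathcomp Require Import boolp classical_sets.
From mathcomp Require Import zify.

(** The VV algebra [W] is a full matrix algebra over the KLR algebra [R], of
size [2 ^ m], with one row for every sign vector [eps].

No entry of a sequence is its own inverse and every entry lies in exactly one
of [I^+] and [I^-], so each sequence has a sign vector, true where the entry
lies in [I^-].  Accordingly [1] is the sum of orthogonal idempotents
[sign_idem eps].  The reflection [pi] flips the first sign and squares to [1],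
as [q] and its inverse are not entries.  A crossing of two strands of different
signs squares to [1] as well, because no arrow joins [I^+] to [I^-].  Hence all
these idempotents are equivalent to [plus_idem], that of the all-plus sign
vector, and it remains to identify [plus_idem * W * plus_idem] with [R].

For the identification, a diagram of [W] on [m] strands is unfolded into a
mirror symmetric diagram on [2 m] strands, in which exactly [m] strands are
labelled by [I^+]; those form a diagram of [R], and they cross the others
freely.  A strand of [W] with a label in [I^-] is replaced by its mirror
image, on the left of the axis.  [pos eps] is the position of each strand
among the chosen ones, [straight] the sequence of their labels, and [crossing]
the crossing of [R] which corresponds to a crossing of two strands of equal
signs.  Read in this way, the generators of [W] act on [R]-valued functions of
the sign vector by monomial matrices which satisfy the relations of [W]
([matrix_vv_laws]); this gives a morphism from [W] to the matrix algebra.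
Conversely the generators of [R] satisfy their relations in the corner
([corner_klr_laws]).  The composite of the two morphisms embeds [R] as a
diagonal corner of the matrix algebra ([Psi_phi]), so the second one is
injective.

Surjectivity onto the corner comes from the elements [transport eps], which
carry [plus_idem] to [sign_idem eps] along a shortest path of flips and mixed
crossings.  Such a path is unique up to commutations of distant generators,
which is why the elements can be written as explicit products and why each
generator moves past them as the matrix model predicts ([mul_transport]).
They form a basis of [W * plus_idem] over [R], with a dual basis
([transport_inverse]), and [frame_morita] turns a basis with a dual basis into
a Morita equivalence.  If [m = 0] both algebras are the field. *)

Set Implicit Arguments.
Unset Strict Implicit.
Unset Printing Implicit Defensive.

Import GRing.Theory.
Local Open Scope ring_scope.

(** * Morita equivalence from a dual basis *)

(** The elements [fr_u s] are a basis, with dual basis [fr_v s], of the right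
[B]-module [A * phi 1], where [phi] embeds [B] into [A] without preserving the
unit; [fr_psi] gives the matrix of the left multiplication by [a]. *)
Record frame (F : fieldType) (A B : kalg F) (S : finType) := Frame {
  fr_u : S -> A;
  fr_v : S -> A;
  fr_phi : B -> A;
  fr_psi : S -> A -> S -> B;
  fr_phiD : forall b c, fr_phi (b + c) = fr_phi b + fr_phi c;
  fr_phiM : forall b c, fr_phi (b * c) = fr_phi b * fr_phi c;
  fr_phiC : forall c, fr_phi (kscal B c) = kscal A c * fr_phi 1;
  fr_phiI : injective fr_phi;
  fr_uphi : forall s, fr_u s * fr_phi 1 = fr_u s;
  fr_phiv : forall s, fr_phi 1 * fr_v s = fr_v s;
  fr_vu : forall s t, fr_v s * fr_u t = if s == t then fr_phi 1 else 0;
  fr_uv : \sum_s fr_u s * fr_v s = 1;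
  fr_psiP : forall s a t, fr_phi (fr_psi s a t) = fr_v s * a * fr_u t }.

(** The frame is an argument only so that the module structure, which depends on
it, can be inferred from the type. *)
Definition frame_mod (F : fieldType) (A B : kalg F) (S : finType)
  (fr : frame A B S) (N : lmodType B) := {ffun S -> N}.

Section FrameFunctors.
Variables (F : fieldType) (A B : kalg F) (S : finType) (fr : frame A B S).
Local Notation u := (fr_u fr).
Local Notation v := (fr_v fr).
Local Notation phi := (fr_phi fr).
Local Notation psi := (fr_psi fr).
Local Notation frame_mod := (frame_mod fr).

Lemma frame_phi0 : phi 0 = 0.
Proof. by apply: (@addrI _ (phi 0)); rewrite -fr_phiD !addr0. Qed.

Lemma frame_phi_sum (I : finType) (f : I -> B) :
  phi (\sum_i f i) = \sum_i phi (f i).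
Proof. exact: (big_morph _ (fr_phiD fr) frame_phi0). Qed.

Lemma frame_phi1l b : phi 1 * phi b = phi b.
Proof. by rewrite -fr_phiM mul1r. Qed.

Lemma frame_psiD s a b t : psi s (a + b) t = psi s a t + psi s b t.
Proof. by apply: (@fr_phiI _ _ _ _ fr); rewrite fr_phiD !fr_psiP mulrDr mulrDl. Qed.

Lemma frame_psi1 s t : psi s 1 t = if s == t then 1 else 0.
Proof.
apply: (@fr_phiI _ _ _ _ fr); rewrite fr_psiP mulr1 fr_vu.
by case: eqP => // _; rewrite frame_phi0.
Qed.

(** The identity, written as the sum of the [u r * v r], is inserted between the
two factors. *)
Lemma frame_psiM s a b t : psi s (a * b) t = \sum_r psi s a r * psi r b t.
Proof.
apply: (@fr_phiI _ _ _ _ fr); rewrite frame_phi_sum fr_psiP.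
under eq_bigr do rewrite fr_phiM !fr_psiP.
rewrite -{1}[a]mulr1 -(fr_uv fr) !(mulr_sumr, mulr_suml).
by apply: eq_bigr => r _; rewrite !mulrA.
Qed.

Lemma frame_psiC s c t :
  psi s (kscal A c) t = if s == t then kscal B c else 0.
Proof.
apply: (@fr_phiI _ _ _ _ fr).
rewrite fr_psiP -kscal_central -mulrA fr_vu.
by case: eqP => // _; rewrite ?frame_phi0 ?mulr0 ?fr_phiC.
Qed.

Section CornerModule.
Variable M : lmodType A.

Definition fixed_pred : {pred M} := fun m => phi 1 *: m == m.

Lemma fixed_zmod_closed : zmod_closed fixed_pred.
Proof.
split=> [|m n]; first by rewrite unfold_in /= scaler0.
by rewrite !unfold_in /= scalerBr => /eqP-> /eqP->.
Qed.
HB.instance Definition _ := GRing.isZmodClosed.Build M fixed_pred fixed_zmod_closed.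

Record corner_mod := CornerMod { cm_val : M; cm_mem : cm_val \in fixed_pred }.
HB.instance Definition _ := [isSub for cm_val].
HB.instance Definition _ := [Choice of corner_mod by <:].
HB.instance Definition _ := [SubChoice_isSubZmodule of corner_mod by <:].

Lemma cm_fixed (m : corner_mod) : phi 1 *: cm_val m = cm_val m.
Proof. exact/eqP/(cm_mem m). Qed.

Lemma fixed_scale a m : phi 1 * a = a -> a *: m \in fixed_pred.
Proof. by move=> ea; rewrite unfold_in /= scalerA ea. Qed.

Definition cm_scale (b : B) (m : corner_mod) : corner_mod :=
  CornerMod (fixed_scale (cm_val m) (frame_phi1l b)).

Lemma cm_valD (m n : corner_mod) : cm_val (m + n) = cm_val m + cm_val n.
Proof. by []. Qed.

Lemma cm_scaleA b c m : cm_scale b (cm_scale c m) = cm_scale (b * c) m.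
Proof. by apply: val_inj; rewrite /= scalerA fr_phiM. Qed.
Lemma cm_scale1 : left_id 1 cm_scale.
Proof. by move=> m; apply: val_inj; exact: cm_fixed. Qed.
Lemma cm_scaleDr : right_distributive cm_scale +%R.
Proof. by move=> b m n; apply: val_inj; rewrite /= scalerDr. Qed.
Lemma cm_scaleDl m : {morph cm_scale^~ m : b c / b + c}.
Proof. by move=> b c; apply: val_inj; rewrite /= fr_phiD scalerDl. Qed.

HB.instance Definition _ := GRing.Zmodule_isLmodule.Build B corner_mod
  cm_scaleA cm_scale1 cm_scaleDr cm_scaleDl.

Lemma cm_valZ b (m : corner_mod) : cm_val (b *: m) = phi b *: cm_val m.
Proof. by []. Qed.

End CornerModule.

Section FrameModule.
Variable N : lmodType B.

HB.instance Definition _ := GRing.Zmodule.copy (frame_mod N) {ffun S -> N}.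

Definition fm_scale (a : A) (n : frame_mod N) : frame_mod N :=
  [ffun s => \sum_t psi s a t *: n t].

Lemma fm_scaleA a b n : fm_scale a (fm_scale b n) = fm_scale (a * b) n.
Proof.
apply/ffunP => s; rewrite !ffunE.
under eq_bigr => t _ do rewrite ffunE scaler_sumr.
rewrite exchange_big /=; apply: eq_bigr => r _.
by rewrite frame_psiM scaler_suml; apply: eq_bigr => t _; rewrite scalerA.
Qed.
Lemma fm_scale1 : left_id 1 fm_scale.
Proof.
move=> n; apply/ffunP => s; rewrite !ffunE (bigD1 s) //= frame_psi1 eqxx scale1r.
by rewrite big1 ?addr0 // => t ts; rewrite frame_psi1 eq_sym (negbTE ts) scale0r.
Qed.
Lemma fm_scaleDr : right_distributive fm_scale +%R.
Proof.
move=> a m n; apply/ffunP => s; rewrite !ffunE -big_split.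
by apply: eq_bigr => t _; rewrite ffunE scalerDr.
Qed.
Lemma fm_scaleDl n : {morph fm_scale^~ n : a b / a + b}.
Proof.
move=> a b; apply/ffunP => s; rewrite !ffunE -big_split.
by apply: eq_bigr => t _; rewrite frame_psiD scalerDl.
Qed.

HB.instance Definition _ := GRing.Zmodule_isLmodule.Build A (frame_mod N)
  fm_scaleA fm_scale1 fm_scaleDr fm_scaleDl.

Lemma fmZE a (n : frame_mod N) s : (a *: n) s = \sum_t psi s a t *: n t.
Proof. exact: ffunE. Qed.

Lemma fmDE (m n : frame_mod N) s : (m + n) s = m s + n s.
Proof. exact: ffunE. Qed.

End FrameModule.

Section CornerMap.
Variables (M N : lmodType A) (f : {linear M -> N}).

Lemma cm_map_fixed (m : corner_mod M) : f (cm_val m) \in @fixed_pred N.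
Proof. by rewrite unfold_in /= -linearZ cm_fixed. Qed.

Definition cm_map (m : corner_mod M) : corner_mod N := CornerMod (cm_map_fixed m).

Lemma cm_map_linear : linear cm_map.
Proof.
by move=> b m n; apply: val_inj; rewrite /= linearP.
Qed.
HB.instance Definition _ :=
  GRing.isLinear.Build B (corner_mod M) (corner_mod N) *:%R cm_map cm_map_linear.
End CornerMap.

Section FrameMap.
Variables (M N : lmodType B) (f : {linear M -> N}).

Definition fm_map (m : frame_mod M) : frame_mod N := [ffun s => f (m s)].

Lemma fm_map_linear : linear fm_map.
Proof.
move=> a m n; apply/ffunP => s.
rewrite !(fmDE, fmZE, ffunE) linearD linear_sum.
by congr (_ + _); apply: eq_bigr => t _; rewrite linearZ ffunE.
Qed.
HB.instance Definition _ :=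
  GRing.isLinear.Build A (frame_mod M) (frame_mod N) *:%R fm_map fm_map_linear.
End FrameMap.

Definition corner_functor : mod_functor A B.
Proof.
refine (@ModFunctor F A B (fun M => corner_mod M) (fun M N f => cm_map f) _ _ _ _ _).
- by move=> M N f g fg m; apply: val_inj; exact: fg.
- by move=> M m; apply: val_inj.
- by move=> M N P g f m; apply: val_inj.
- by move=> M N f g h hE m; apply: val_inj; exact: hE.
- move=> M N c f h hE m; apply: val_inj.
  by rewrite /= hE fr_phiC -scalerA; congr (_ *: _); rewrite -linearZ cm_fixed.
Defined.

Definition frame_functor : mod_functor B A.
Proof.
refine (@ModFunctor F B A (fun N => frame_mod N) (fun M N f => fm_map f) _ _ _ _ _).
- by move=> M N f g fg m; apply/ffunP => s; rewrite !ffunE.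
- by move=> M m; apply/ffunP => s; rewrite !ffunE.
- by move=> M N P g f m; apply/ffunP => s; rewrite !ffunE.
- by move=> M N f g h hE m; apply/ffunP => s; rewrite !(fmDE, ffunE).
- move=> M N c f h hE m; apply/ffunP => s.
  rewrite fmZE ffunE hE (bigD1 s) //= frame_psiC eqxx ffunE.
  by rewrite big1 ?addr0 // => t ts; rewrite frame_psiC eq_sym (negbTE ts) scale0r.
Defined.

Section Counit.
Variable M : lmodType A.

(** The counit of the equivalence: the multiplication map from the induced module
back to [M]. *)
Definition frame_sum (m : frame_mod (corner_mod M)) : M := \sum_s u s *: cm_val (m s).

Lemma cm_val_sum (I : finType) (f : I -> corner_mod M) :
  cm_val (\sum_i f i) = \sum_i cm_val (f i).
Proof. exact: (big_morph (@cm_val M) (@cm_valD M) (erefl _)). Qed.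

Lemma frame_sum_linear : linear frame_sum.
Proof.
move=> a m n; rewrite /frame_sum.
under eq_bigr => s _ do rewrite fmDE cm_valD scalerDr fmZE cm_val_sum.
rewrite big_split /=; congr (_ + _); rewrite scaler_sumr.
under eq_bigr do rewrite scaler_sumr.
rewrite exchange_big; apply: eq_bigr => t _ /=.
under eq_bigr do rewrite fr_psiP !scalerA !mulrA.
by rewrite -scaler_suml -!mulr_suml fr_uv mul1r scalerA.
Qed.
HB.instance Definition _ :=
  GRing.isLinear.Build A (frame_mod (corner_mod M)) M *:%R frame_sum frame_sum_linear.

Definition frame_coord (m : M) : frame_mod (corner_mod M) :=
  [ffun s => CornerMod (fixed_scale m (fr_phiv fr s))].

Lemma frame_sum_bij : bijective frame_sum.
Proof.
exists frame_coord => m.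
  apply/ffunP => s; rewrite ffunE; apply: val_inj => /=.
  rewrite scaler_sumr (bigD1 s) //= scalerA fr_vu eqxx cm_fixed big1 ?addr0 // => t ts.
  by rewrite scalerA fr_vu eq_sym (negbTE ts) scale0r.
rewrite /frame_sum; under eq_bigr => s _ do rewrite ffunE /= scalerA.
by rewrite -scaler_suml fr_uv scale1r.
Qed.
End Counit.

Section Unit.
Variables (N : lmodType B) (s0 : S) (us0 : u s0 = phi 1) (vs0 : v s0 = phi 1).

Definition frame_base (n : corner_mod (frame_mod N)) : N := cm_val n s0.

Lemma frame_psi_phi s b : psi s (phi b) s0 = if s == s0 then b else 0.
Proof.
apply: (@fr_phiI _ _ _ _ fr); rewrite fr_psiP us0.
rewrite -mulrA -fr_phiM mulr1 -{1}[b]mul1r fr_phiM -us0 mulrA fr_vu.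
by case: eqP => // _; rewrite ?frame_phi1l // mul0r frame_phi0.
Qed.

Lemma frame_psi_phi_row b t : psi s0 (phi b) t = if s0 == t then b else 0.
Proof.
apply: (@fr_phiI _ _ _ _ fr); rewrite fr_psiP vs0.
rewrite frame_phi1l -{1}[b]mulr1 fr_phiM -vs0 -mulrA fr_vu.
by case: eqP => // _; rewrite ?mulr0 ?frame_phi0 // -fr_phiM mulr1.
Qed.

Lemma frame_base_linear : linear frame_base.
Proof.
move=> b m n; rewrite /frame_base cm_valD fmDE cm_valZ fmZE; congr (_ + _).
rewrite (bigD1 s0) //= frame_psi_phi_row eqxx big1 ?addr0 // => t ts.
by rewrite frame_psi_phi_row eq_sym (negbTE ts) scale0r.
Qed.

Lemma frame_base_outside (n : corner_mod (frame_mod N)) s :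
  s != s0 -> cm_val n s = 0.
Proof.
move=> ss0; rewrite -cm_fixed fmZE big1 // => t _.
suff -> : psi s (phi 1) t = 0 by rewrite scale0r.
by apply: (@fr_phiI _ _ _ _ fr); rewrite fr_psiP -us0 fr_vu (negbTE ss0) mul0r frame_phi0.
Qed.

Lemma frame_base_fixed (n : N) :
  ([ffun s => if s == s0 then n else 0] : frame_mod N) \in @fixed_pred (frame_mod N).
Proof.
apply/eqP/ffunP => s; rewrite fmZE ffunE (bigD1 s0) //= ffunE eqxx big1.
  by rewrite frame_psi_phi addr0; case: eqP => _; rewrite ?scale1r ?scale0r.
by move=> t ts; rewrite ffunE (negbTE ts) scaler0.
Qed.

Lemma frame_base_bij : bijective frame_base.
Proof.
exists (fun n => CornerMod (frame_base_fixed n)) => n; last by rewrite /frame_base ffunE eqxx.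
apply: val_inj; apply/ffunP => s; rewrite ffunE /frame_base.
by case: eqP => [->//|/eqP ss0]; rewrite frame_base_outside.
Qed.
End Unit.
End FrameFunctors.

(** If one of the basis elements is the unit of the corner itself, evaluation at
its index is inverse to induction; the other composite is the identity by the
dual basis property. *)
Theorem frame_morita (F : fieldType) (A B : kalg F) (S : finType)
    (fr : frame A B S) (s0 : S) :
  fr_u fr s0 = fr_phi fr 1 -> fr_v fr s0 = fr_phi fr 1 -> morita_equivalent A B.
Proof.
move=> us0 vs0; exists (corner_functor fr), (frame_functor fr); split.
  exists (fun M => frame_sum (fr := fr) (M := M)); split.
    by move=> M; exact: frame_sum_bij.
  move=> M N f m; rewrite /= /frame_sum linear_sum; apply: eq_bigr => s _.
  by rewrite linearZ ffunE.
have base_lin N := @frame_base_linear _ _ _ _ fr N s0 vs0.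
pose mx N := GRing.isLinear.Build B (corner_mod fr (frame_mod fr N)) N *:%R _ (base_lin N).
pose eta N : {linear corner_mod fr (frame_mod fr N) -> N} :=
  HB.pack (@frame_base _ _ _ _ fr N s0) (mx N).
exists eta; split; first by move=> N; exact: frame_base_bij.
by move=> M N f m; rewrite /= /frame_base ffunE.
Qed.

(** * Corner algebras, monomial matrices, presented algebras *)

Section CornerAlgebra.
Variables (F : fieldType) (A : kalg F) (e : A) (ee : e * e = e).

(** The idempotency proof is an argument so that the ring structure of the corner
can be inferred from the type of its elements. *)
Definition corner_pred (_ : e * e = e) : {pred A} := fun a => (e * a == a) && (a * e == a).
Local Notation cpred := (corner_pred ee).

Lemma cornerP a : reflect (e * a = a /\ a * e = a) (a \in cpred).
Proof. by apply: (iffP andP) => [[/eqP-> /eqP->]|[-> ->]]. Qed.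

Lemma corner_zmod_closed : zmod_closed cpred.
Proof.
split=> [|a b /cornerP[ea ae] /cornerP[eb be]]; apply/cornerP.
  by rewrite mulr0 mul0r.
by rewrite mulrBr mulrBl ea ae eb be.
Qed.
HB.instance Definition _ := GRing.isZmodClosed.Build A cpred corner_zmod_closed.

Record corner := Corner { corner_val : A; corner_mem : corner_val \in cpred }.
HB.instance Definition _ := [isSub for corner_val].
HB.instance Definition _ := [Choice of corner by <:].
HB.instance Definition _ := [SubChoice_isSubZmodule of corner by <:].

Lemma corner_mull (a : corner) : e * corner_val a = corner_val a.
Proof. by case/cornerP: (corner_mem a). Qed.
Lemma corner_mulr (a : corner) : corner_val a * e = corner_val a.
Proof. by case/cornerP: (corner_mem a). Qed.

Lemma corner_one_mem : e \in cpred.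
Proof. by apply/cornerP; rewrite ee. Qed.
Lemma corner_mul_mem (a b : corner) : corner_val a * corner_val b \in cpred.
Proof. by apply/cornerP; rewrite mulrA corner_mull -mulrA corner_mulr. Qed.
Lemma corner_scal_mem c : kscal A c * e \in cpred.
Proof. by apply/cornerP; rewrite mulrA -kscal_central -!mulrA ee. Qed.

Definition corner_one := Corner corner_one_mem.
Definition corner_mul a b := Corner (corner_mul_mem a b).
Definition corner_scal c := Corner (corner_scal_mem c).

Lemma corner_mulA : associative corner_mul.
Proof. by move=> a b c; apply: val_inj; rewrite /= mulrA. Qed.
Lemma corner_mul1 : left_id corner_one corner_mul.
Proof. by move=> a; apply: val_inj; rewrite /= corner_mull. Qed.
Lemma corner_1mul : right_id corner_one corner_mul.
Proof. by move=> a; apply: val_inj; rewrite /= corner_mulr. Qed.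
Lemma corner_mulDl : left_distributive corner_mul +%R.
Proof. by move=> a b c; apply: val_inj; rewrite /= mulrDl. Qed.
Lemma corner_mulDr : right_distributive corner_mul +%R.
Proof. by move=> a b c; apply: val_inj; rewrite /= mulrDr. Qed.
HB.instance Definition _ := GRing.Zmodule_isPzRing.Build corner
  corner_mulA corner_mul1 corner_1mul corner_mulDl corner_mulDr.

Lemma corner_scal_zmod : zmod_morphism corner_scal.
Proof. by move=> c d; apply: val_inj; rewrite /= rmorphB mulrBl. Qed.
Lemma corner_scal_monoid : monoid_morphism corner_scal.
Proof.
split=> [|c d]; apply: val_inj; rewrite /= ?rmorph1 ?mul1r //.
by rewrite rmorphM -!mulrA [e * (_ * _)]mulrA -(kscal_central d e) -mulrA ee.
Qed.
HB.instance Definition _ := GRing.isZmodMorphism.Build F corner corner_scal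
  corner_scal_zmod.
HB.instance Definition _ := GRing.isMonoidMorphism.Build F corner corner_scal
  corner_scal_monoid.

Lemma corner_scal_central c (a : corner) : corner_scal c * a = a * corner_scal c.
Proof.
apply: val_inj; rewrite /= mulrA -kscal_central -!mulrA.
by rewrite corner_mull corner_mulr.
Qed.

Definition corner_alg : kalg F := KAlg corner_scal_central.
End CornerAlgebra.

Section MatrixAlgebra.
Variables (F : fieldType) (B : kalg F) (n : nat).

Lemma mx_scal_zmod : zmod_morphism (fun c => (kscal B c)%:M : 'M[B]_n).
Proof. by move=> c d; rewrite !rmorphB. Qed.
Lemma mx_scal_monoid : monoid_morphism (fun c => (kscal B c)%:M : 'M[B]_n).
Proof. by split=> [|c d]; rewrite ?rmorph1 // rmorphM scalar_mxM. Qed.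
Definition mx_scal c : 'M[B]_n := (kscal B c)%:M.
HB.instance Definition _ := GRing.isZmodMorphism.Build F 'M[B]_n mx_scal mx_scal_zmod.
HB.instance Definition _ := GRing.isMonoidMorphism.Build F 'M[B]_n mx_scal mx_scal_monoid.

(** The entries of a scalar matrix with value in the field are central, which
replaces the commutativity of the coefficients. *)
Lemma mx_scal_central c (M : 'M[B]_n) : mx_scal c * M = M * mx_scal c.
Proof.
rewrite /mx_scal; apply/matrixP => i j.
rewrite -[LHS]/((_ *m _) i j) -[RHS]/((_ *m _) i j) mul_scalar_mx !mxE.
rewrite (bigD1 j) //= big1 ?addr0 => [|k kj]; rewrite mxE ?eqxx ?mulr1n ?kscal_central //.
by rewrite (negbTE kj) mulr0.
Qed.

Definition mx_alg : kalg F := KAlg mx_scal_central.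
End MatrixAlgebra.

Section Monomial.
Variables (F : fieldType) (B : kalg F) (S : finType).
Local Notation MS := (mx_alg B #|S|).

(** The matrix of a map which sends the basis vector [s] to [a s] times the basis
vector [f s]. Sums of such matrices with the same [f] remain monomial, so all
relations below are checked column by column in the coefficients. *)
Definition mono (f : S -> S) (a : S -> B) : MS :=
  \matrix_(i, j) (if enum_val i == f (enum_val j) then a (enum_val j) else 0).

Lemma monoM f a g b :
  mono f a * mono g b = mono (fun s => f (g s)) (fun s => a (g s) * b s).
Proof.
apply/matrixP => i j; rewrite !mxE (bigD1 (enum_rank (g (enum_val j)))) //=.
rewrite !mxE !enum_rankK eqxx big1 ?addr0; first by case: eqP => //; rewrite mul0r.
move=> k kj; rewrite !mxE; case: (enum_val k =P _) => [kE|_]; last by rewrite mulr0.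
by rewrite -kE enum_valK eqxx in kj.
Qed.

Lemma monoD f a b : mono f a + mono f b = mono f (fun s => a s + b s).
Proof. by apply/matrixP => i j; rewrite !mxE; case: eqP => // _; rewrite addr0. Qed.

Lemma monoN f a : - mono f a = mono f (fun s => - a s).
Proof. by apply/matrixP => i j; rewrite !mxE; case: eqP => // _; rewrite oppr0. Qed.

Lemma mono_scal c : kscal MS c = mono id (fun=> kscal B c).
Proof.
apply/matrixP => i j; rewrite !mxE (inj_eq enum_val_inj).
by case: eqP => _; rewrite ?mulr1n ?mulr0n.
Qed.

Lemma mono1 : mono id (fun=> 1) = 1.
Proof. by rewrite -[RHS](rmorph1 (kscal MS)) mono_scal rmorph1. Qed.

Lemma mono0 f : mono f (fun=> 0) = 0.
Proof. by apply/matrixP => i j; rewrite !mxE if_same. Qed.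

Lemma mono_sum (I : finType) f (a : I -> S -> B) :
  \sum_i mono f (a i) = mono f (fun s => \sum_i a i s).
Proof.
apply/matrixP => i j; rewrite summxE mxE.
under eq_bigr do rewrite mxE.
by case: ifP => // _; rewrite big1.
Qed.

(** The function only matters where the coefficient does not vanish. *)
Lemma mono_eq f a g b :
    (forall s, a s = b s) -> (forall s, a s <> 0 -> f s = g s) ->
  mono f a = mono g b.
Proof.
move=> ab fg; apply/matrixP => i j; rewrite !mxE -ab.
have [->|/eqP/fg ->//] := eqVneq (a (enum_val j)) 0; by rewrite !if_same.
Qed.

Lemma monoE f a s t :
  mono f a (enum_rank s) (enum_rank t) = if s == f t then a t else 0.
Proof. by rewrite mxE !enum_rankK. Qed.
End Monomial.

Section PresentedInduction.
Variables (F : fieldType) (T : Type) (rel : aexpr F T -> aexpr F T -> Prop).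

(** Stated for predicates on the quotient, so that no representatives appear in the
proofs by induction on the elements of a presented algebra. *)
Lemma presented_ind (P : presented rel -> Prop) :
    (forall x, P (cls rel (TVar x))) -> (forall c, P (kscal (presented rel) c)) ->
    (forall a b, P a -> P b -> P (a + b)) -> (forall a b, P a -> P b -> P (a * b)) ->
  forall a, P a.
Proof.
move=> Px Pc PD PM; elim/cls_ind; elim=> [x|c|s IHs t IHt|s IHs t IHt].
- exact: Px.
- exact: Pc.
- by have := PD _ _ IHs IHt; rewrite -[_ + _]/(pres_add _ _) cls_add.
- by have := PM _ _ IHs IHt; rewrite -[_ * _]/(pres_mul _ _) cls_mul.
Qed.

Lemma teval_cls t :
  teval (A := presented rel) (fun x => cls rel (TVar x)) t = cls rel t.
Proof. by elim: t => //= s -> t ->; [exact: cls_add | exact: cls_mul]. Qed.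

Lemma presented_rel s t : rel s t ->
  teval (A := presented rel) (fun x => cls rel (TVar x)) s =
  teval (A := presented rel) (fun x => cls rel (TVar x)) t.
Proof. by move=> st; rewrite !teval_cls; apply: cls_eq; apply: congr_rel. Qed.
End PresentedInduction.

(** * Signs and the straightening permutation *)

Section Signs.
Variable n : nat.
Implicit Types (k : 'I_n) (l : 'I_n.+1).
Local Notation sw k := (tperm (lo k) (hi k)).

Definition sgn := {ffun 'I_n.+1 -> bool}.
HB.instance Definition _ := Finite.on sgn.
Implicit Types (eps : sgn).

Definition swap_nat (k l : nat) : nat :=
  if l == k then k.+1 else if l == k.+1 then k else l.

Lemma val_lo k : lo k = k :> nat. Proof. by []. Qed.
Lemma val_hi k : hi k = k.+1 :> nat. Proof. exact: lift0. Qed.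

Lemma lo_neq_hi k : lo k != hi k.
Proof. by apply/eqP => /(congr1 (@nat_of_ord _)); rewrite val_hi val_lo; lia. Qed.

Lemma val_sw k l : sw k l = swap_nat k l :> nat.
Proof.
rewrite /swap_nat -(val_lo k) -(val_hi k) !val_eqE.
case: tpermP => [->|->|/eqP/negbTE-> /eqP/negbTE->//]; rewrite ?eqxx //.
by rewrite eq_sym (negbTE (lo_neq_hi k)).
Qed.

Lemma sw_far k k' l : (k.+1 < k')%N || (k'.+1 < k)%N ->
  sw k (sw k' l) = sw k' (sw k l).
Proof.
move=> far; apply: ord_inj; rewrite !val_sw /swap_nat.
by do !case: ifPn; lia.
Qed.

Lemma sw_braid k k' l : k' = k.+1 :> nat ->
  sw k (sw k' (sw k l)) = sw k' (sw k (sw k' l)).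
Proof.
move=> kk'; apply: ord_inj; rewrite !val_sw /swap_nat kk'.
by do !case: ifPn; lia.
Qed.

Definition swap_sgn k eps : sgn := [ffun l => eps (sw k l)].
Definition flip_sgn eps : sgn := [ffun l => if l == ord0 then ~~ eps l else eps l].
Definition plus_sgn : sgn := [ffun=> false].

Lemma swap_sgnK k : involutive (swap_sgn k).
Proof. by move=> eps; apply/ffunP => l; rewrite !ffunE tpermK. Qed.

Lemma flip_sgnK : involutive flip_sgn.
Proof. by move=> eps; apply/ffunP => l; rewrite !ffunE; case: eqP; rewrite ?negbK. Qed.

Lemma swap_sgn_id k eps : eps (lo k) = eps (hi k) -> swap_sgn k eps = eps.
Proof. by move=> E; apply/ffunP => l; rewrite ffunE; case: tpermP => [->|->|]. Qed.

Lemma swap_sgn_lo k eps : swap_sgn k eps (lo k) = eps (hi k).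
Proof. by rewrite ffunE tpermL. Qed.
Lemma swap_sgn_hi k eps : swap_sgn k eps (hi k) = eps (lo k).
Proof. by rewrite ffunE tpermR. Qed.

Lemma swap_sgn_far k k' eps : (k.+1 < k')%N || (k'.+1 < k)%N ->
  swap_sgn k (swap_sgn k' eps) = swap_sgn k' (swap_sgn k eps).
Proof. by move=> far; apply/ffunP => l; rewrite !ffunE -(sw_far _ far). Qed.

Lemma swap_sgn_braid k k' eps : k' = k.+1 :> nat ->
  swap_sgn k (swap_sgn k' (swap_sgn k eps)) =
  swap_sgn k' (swap_sgn k (swap_sgn k' eps)).
Proof. by move=> kk'; apply/ffunP => l; rewrite !ffunE sw_braid. Qed.

Lemma swap_flip_sgn k eps : k != 0%N :> nat ->
  swap_sgn k (flip_sgn eps) = flip_sgn (swap_sgn k eps).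
Proof.
move=> k0; apply/ffunP => l; rewrite !ffunE; congr (if _ then ~~ _ else _).
by rewrite -!val_eqE /= val_sw /swap_nat; do !case: ifPn; lia.
Qed.

(** Both sides exchange and flip the first two signs: this is the braid relation of
type B. *)
Lemma swap_flip_braid k eps : k = 0%N :> nat ->
  swap_sgn k (flip_sgn (swap_sgn k (flip_sgn eps))) =
  flip_sgn (swap_sgn k (flip_sgn (swap_sgn k eps))).
Proof.
move=> k0; apply/ffunP => l; rewrite !ffunE -!val_eqE /= !val_sw tpermK /swap_nat k0.
by case: (nat_of_ord l) => [|[|m]].
Qed.

(** Position of strand [l] among the [2(n+1)] strands of the unfolded diagram:
an inverted strand contributes its mirror image, which lies on the left. *)
Definition key eps l : nat := (if eps l then n - l else n.+1 + l)%N.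

Definition rank eps l : nat := #|[set j | key eps j < key eps l]%N|.

Lemma key_inj eps : injective (key eps).
Proof.
move=> j l; rewrite /key => jl; apply: ord_inj.
have := ltn_ord j; have := ltn_ord l; move: jl.
by case: (eps j); case: (eps l); rewrite /=; lia.
Qed.

Lemma rank_mono eps (j l : 'I_n.+1) : (rank eps j < rank eps l)%N = (key eps j < key eps l)%N.
Proof.
have mono i i' : (key eps i < key eps i')%N -> (rank eps i < rank eps i')%N.
  move=> ii'; apply: proper_card; apply/properP; split.
    by apply/fintype.subsetP => a; rewrite !inE => /ltn_trans; apply.
  by exists i; rewrite !inE ?ltnn.
case: (ltngtP (key eps j) (key eps l)) => [/mono //|/mono|/key_inj->]; last by rewrite ltnn.
by move=> /ltnW; rewrite leqNgt => /negbTE.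
Qed.

Lemma rank_lt eps l : (rank eps l < n.+1)%N.
Proof.
rewrite -[X in (_ < X)%N](card_ord n.+1) -cardsT; apply: proper_card; apply/properP.
by split; [exact: finset.subsetT | exists l; rewrite !inE ?ltnn].
Qed.

Definition pos_fun eps l : 'I_n.+1 := Ordinal (rank_lt eps l).

Lemma pos_inj eps : injective (pos_fun eps).
Proof.
move=> j l /(congr1 val) /= jl; apply: (@key_inj eps).
by case: (ltngtP (key eps j) (key eps l)) => //; rewrite -rank_mono jl ltnn.
Qed.

Definition pos eps : 'S_n.+1 := perm (@pos_inj eps).

Lemma val_pos eps l : pos eps l = rank eps l :> nat.
Proof. by rewrite permE. Qed.

Lemma rank_reindex eps eps' (f : 'S_n.+1) l :
    (forall j, (key eps j < key eps l)%N = (key eps' (f j) < key eps' (f l))%N) ->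
  rank eps l = rank eps' (f l).
Proof.
move=> E; rewrite /rank -[RHS](card_preimset _ (@perm_inj _ f)); apply: eq_card => j.
by rewrite !inE E.
Qed.

(** The first strand and its mirror image are neighbours in the unfolded diagram,
so choosing one or the other changes no relative position. *)
Lemma pos_flip eps : pos (flip_sgn eps) = pos eps.
Proof.
apply/permP => l; apply: ord_inj; rewrite !val_pos.
rewrite (@rank_reindex _ eps 1%g) perm1 // => j; rewrite perm1.
have keyE i : key (flip_sgn eps) i = if i == 0%N :> nat
    then if eps i then n.+1 else n else key eps i.
  rewrite /key ffunE -val_eqE /=; case: eqP => // ->.
  by case: (eps i); rewrite ?subn0 ?addn0.
have key0 (i : 'I_n.+1) : i != 0%N :> nat -> (key eps i < n)%N || (n.+1 < key eps i)%N.
  by rewrite /key; have := ltn_ord i; case: (eps i); lia.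
have keyz (i : 'I_n.+1) : i = 0%N :> nat -> key eps i = if eps i then n else n.+1.
  by rewrite /key => ->; case: (eps i); rewrite ?subn0 ?addn0.
rewrite !keyE; case: (eqVneq (j : nat) 0%N) => [j0|/key0 Hj];
  case: (eqVneq (l : nat) 0%N) => [l0|/key0 Hl]; rewrite ?(keyz _ j0) ?(keyz _ l0) //.
- have -> : j = l by apply: ord_inj; rewrite j0.
  by rewrite !ltnn.
- by case: (eps j); move: Hl; lia.
- by case: (eps l); move: Hj; lia.
Qed.

(** Strands of different signs lie on different sides of the axis of the unfolded
diagram, so exchanging two neighbours only relabels the strands. *)
Lemma pos_swap eps k l :
  eps (lo k) != eps (hi k) -> pos (swap_sgn k eps) l = pos eps (sw k l).
Proof.
move=> mixed; apply: ord_inj; rewrite !val_pos.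
have kl : key (swap_sgn k eps) (lo k) = (if eps (hi k) then n - k else n.+1 + k)%N.
  by rewrite /key swap_sgn_lo.
have kh : key (swap_sgn k eps) (hi k) = (if eps (lo k) then n - k.+1 else n.+1 + k.+1)%N.
  by rewrite /key swap_sgn_hi val_hi.
have kl' : key eps (lo k) = (if eps (lo k) then n - k else n.+1 + k)%N by [].
have kh' : key eps (hi k) = (if eps (hi k) then n - k.+1 else n.+1 + k.+1)%N.
  by rewrite /key val_hi.
have ko (i : 'I_n.+1) : i <> lo k -> i <> hi k ->
    key (swap_sgn k eps) i = key eps i /\
    [|| key eps i + k.+1 < n, (n < key eps i + k) && (key eps i < n.+1 + k) |
        n.+1 + k.+1 < key eps i]%N.
  move=> /eqP il /eqP ih; rewrite /key ffunE tpermD 1?eq_sym //; split=> //.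
  move: il ih; rewrite -!val_eqE [val (hi k)]val_hi /=.
  by have := ltn_ord i; have := ltn_ord k; case: (eps i); lia.
have ltk := ltn_ord k; apply: rank_reindex => j.
case: (tpermP (lo k) (hi k) j) => [->|->|/ko{}ko1 /ko1{ko1}[-> Hj]];
  case: (tpermP (lo k) (hi k) l) => [->|->|/ko{}ko1 /ko1{ko1}[-> Hl]];
  rewrite ?ltnn ?kl ?kh ?kl' ?kh' //; move: mixed;
  case: (eps (lo k)); case: (eps (hi k)) => //= _; lia.
Qed.

Lemma rank_succ eps (j l : 'I_n.+1) :
  (key eps l = (key eps j).+1)%N -> rank eps l = (rank eps j).+1.
Proof.
move=> E; rewrite /rank.
have -> : [set i | (key eps i < key eps l)%N] = j |: [set i | (key eps i < key eps j)%N].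
  by apply/setP => i; rewrite !inE E ltnS leq_eqVlt (inj_eq (@key_inj eps)).
by rewrite cardsU1 inE ltnn.
Qed.

(** Adjacent strands of equal signs stay adjacent; on the left of the axis their
order is reversed. *)
Lemma pos_succ eps k : eps (lo k) = eps (hi k) ->
  if eps (lo k) then pos eps (lo k) = (pos eps (hi k)).+1 :> nat
  else pos eps (hi k) = (pos eps (lo k)).+1 :> nat.
Proof.
move=> E; case: ifPn => [|/negbTE] El; rewrite !val_pos;
  apply: rank_succ; rewrite /key -E El val_hi ?val_lo; last by lia.
by have := ltn_ord k; rewrite /=; lia.
Qed.

Lemma pos_plus l : pos plus_sgn l = l.
Proof.
apply: ord_inj; rewrite val_pos /rank.
have -> : [set j | (key plus_sgn j < key plus_sgn l)%N] = [set j : 'I_n.+1 | (j < l)%N].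
  by apply/setP => j; rewrite !inE /key !ffunE ltn_add2l.
rewrite -sum1_card (eq_bigl (fun j : 'I_n.+1 => j < l)%N); last by move=> j; rewrite inE.
by rewrite -(big_ord_widen _ (fun=> 1%N) (ltnW (ltn_ord l))) sum1_card card_ord.
Qed.

(** The crossing of the straightened diagram to which the crossing of the
strands [k] and [k+1] corresponds when they have the same sign; the default
value of [insubd] is never reached. *)
Definition crossing eps k : 'I_n :=
  insubd k (minn (pos eps (lo k)) (pos eps (hi k))).

Lemma val_crossing eps k :
  crossing eps k = minn (pos eps (lo k)) (pos eps (hi k)) :> nat.
Proof.
rewrite val_insubd ifT //.
have : pos eps (lo k) != pos eps (hi k) by rewrite (inj_eq perm_inj) lo_neq_hi.
rewrite -val_eqE /=; have := ltn_ord (pos eps (lo k)); have := ltn_ord (pos eps (hi k)).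
by lia.
Qed.

Lemma crossing_lohi eps k : eps (lo k) = eps (hi k) ->
  if eps (lo k) then lo (crossing eps k) = pos eps (hi k) /\
                     hi (crossing eps k) = pos eps (lo k)
  else lo (crossing eps k) = pos eps (lo k) /\ hi (crossing eps k) = pos eps (hi k).
Proof.
move=> E; have := pos_succ E; have := val_crossing eps k.
by case: ifP => _ H1 H2; split; apply: ord_inj; rewrite ?val_hi ?val_lo; move: H1 H2; lia.
Qed.

Lemma sw_crossing eps k l : eps (lo k) = eps (hi k) ->
  sw (crossing eps k) (pos eps l) = pos eps (sw k l).
Proof.
move=> E; have := crossing_lohi E.
have pL := inj_tperm (lo k) (hi k) l (@perm_inj _ (pos eps)).
by case: ifP => _ [-> ->]; rewrite pL // tpermC.
Qed.

Lemma crossing_plus k : crossing plus_sgn k = k.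
Proof.
by apply: ord_inj; rewrite val_crossing !pos_plus val_hi val_lo; lia.
Qed.

Lemma crossing_flip eps k : crossing (flip_sgn eps) k = crossing eps k.
Proof. by apply: ord_inj; rewrite !val_crossing pos_flip. Qed.

Lemma crossing_swap eps k j : eps (lo k) != eps (hi k) ->
  crossing (swap_sgn k eps) j =
    minn (pos eps (sw k (lo j))) (pos eps (sw k (hi j))) :> nat.
Proof. by move=> mixed; rewrite val_crossing !pos_swap. Qed.

Lemma swap_sgn_lo_far k (j : 'I_n) eps : (k.+1 < j)%N || (j.+1 < k)%N ->
  (swap_sgn k eps (lo j) = eps (lo j)) * (swap_sgn k eps (hi j) = eps (hi j)).
Proof.
by move=> far; rewrite !ffunE; split; congr (eps _); apply: ord_inj;
  rewrite val_sw /swap_nat ?val_hi ?val_lo; do !case: ifPn; lia.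
Qed.

Lemma crossing_far eps k (j : 'I_n) : (k.+1 < j)%N || (j.+1 < k)%N ->
  crossing (swap_sgn k eps) j = crossing eps j.
Proof.
move=> far; have [E|mixed] := eqVneq (eps (lo k)) (eps (hi k)).
  by rewrite swap_sgn_id.
apply: ord_inj; rewrite crossing_swap // val_crossing.
by congr minn; congr (_ (pos eps _)); apply: ord_inj;
  rewrite val_sw /swap_nat ?val_hi ?val_lo; do !case: ifPn; lia.
Qed.

(** Distant crossings involve four different strands, hence stay distant after
straightening. *)
Lemma crossing_far_far eps k (j : 'I_n) : (k.+1 < j)%N || (j.+1 < k)%N ->
    eps (lo k) = eps (hi k) -> eps (lo j) = eps (hi j) ->
  ((crossing eps k).+1 < crossing eps j)%N || ((crossing eps j).+1 < crossing eps k)%N.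
Proof.
move=> far Ek Ej; have := crossing_lohi Ek; have := crossing_lohi Ej.
have posN (i i' : 'I_n.+1) : i != i' :> nat -> pos eps i != pos eps i' :> nat.
  by rewrite !(inj_eq val_inj) (inj_eq perm_inj).
have H1 : pos eps (hi k) != pos eps (hi j) :> nat by apply: posN; rewrite !val_hi; lia.
have H2 : pos eps (hi k) != pos eps (lo j) :> nat by apply: posN; rewrite val_hi /=; lia.
have H3 : pos eps (lo k) != pos eps (hi j) :> nat by apply: posN; rewrite val_hi /=; lia.
have H4 : pos eps (lo k) != pos eps (lo j) :> nat by apply: posN; rewrite /=; lia.
have eqn (a b : 'I_n.+1) : a = b -> a = b :> nat by move=> ->.
case: ifP => _ [/eqn A1 /eqn A2]; case: ifP => _ [/eqn A3 /eqn A4];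
  move: A1 A2 A3 A4; rewrite !val_lo !val_hi; lia.
Qed.

Section Adjacent.
Variables (k k' : 'I_n) (kk' : k' = k.+1 :> nat).

Lemma lo_succ : lo k' = hi k.
Proof. by apply: ord_inj; rewrite val_hi val_lo. Qed.

Lemma sw_adj : (sw k (hi k') = hi k') * (sw k' (lo k) = lo k) *
  (sw k' (hi k) = hi k') * (sw k' (hi k') = hi k).
Proof.
have sk : sw k (hi k') = hi k'.
  by apply: ord_inj; rewrite val_sw /swap_nat !val_hi kk'; do !case: ifPn; lia.
have sk' : sw k' (lo k) = lo k.
  by apply: ord_inj; rewrite val_sw /swap_nat !val_lo kk'; do !case: ifPn; lia.
by rewrite sk sk' -[X in sw k' X]lo_succ tpermL tpermR lo_succ.
Qed.

Lemma crossing_succ eps :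
    eps (lo k) = eps (hi k) -> eps (hi k) = eps (hi k') ->
  if eps (lo k) then crossing eps k = (crossing eps k').+1 :> nat
  else crossing eps k' = (crossing eps k).+1 :> nat.
Proof.
move=> E1 E2; have := crossing_lohi E1; have := @crossing_lohi eps k'.
rewrite lo_succ E1 => /(_ E2); case: ifP => _ [H1 H2] [H3 H4].
  by rewrite -val_hi H2 -H3.
by rewrite -val_hi H4 -H1.
Qed.

(** Moving a strand of the opposite sign across a crossing does not change the
crossing of the straightened diagram. *)
Lemma crossing_adj eps :
  [/\ eps (lo k) = eps (hi k) -> eps (hi k) != eps (hi k') ->
        crossing (swap_sgn k (swap_sgn k' eps)) k' = crossing eps k,
      eps (hi k) = eps (hi k') -> eps (lo k) != eps (hi k) ->
        crossing (swap_sgn k' (swap_sgn k eps)) k = crossing eps k'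
    & eps (lo k) = eps (hi k') -> eps (lo k) != eps (hi k) ->
        crossing (swap_sgn k' eps) k = crossing (swap_sgn k eps) k'].
Proof.
have adj : tperm (hi k) (hi k') (lo k) = lo k by rewrite -{1}lo_succ sw_adj.
have vk (eps' : sgn) : (swap_sgn k eps' (lo k') = eps' (lo k)) *
    (swap_sgn k eps' (hi k') = eps' (hi k')).
  by rewrite lo_succ swap_sgn_hi ffunE sw_adj.
have vk' (eps' : sgn) : (swap_sgn k' eps' (lo k) = eps' (lo k)) *
    (swap_sgn k' eps' (hi k) = eps' (hi k')).
  by rewrite !ffunE !sw_adj.
split=> E mixed; apply: ord_inj; rewrite !val_crossing.
- rewrite !(@pos_swap (swap_sgn k' eps) k) ?vk' ?E // !(@pos_swap eps k') ?lo_succ //.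
  by rewrite !(sw_adj, tpermL, tpermR, adj).
- rewrite !(@pos_swap (swap_sgn k eps) k') ?vk -?E // !(@pos_swap eps k) //.
  by rewrite !(sw_adj, tpermL, tpermR, adj) lo_succ.
- rewrite !(@pos_swap eps k) // !(@pos_swap eps k') ?lo_succ -?E 1?eq_sym //.
  by rewrite !(sw_adj, tpermL, tpermR, adj).
Qed.

End Adjacent.

Lemma crossing_swap_self eps k : eps (lo k) != eps (hi k) ->
  crossing (swap_sgn k eps) k = crossing eps k.
Proof.
by move=> mixed; apply: ord_inj; rewrite crossing_swap // tpermL tpermR minnC val_crossing.
Qed.

Definition weight eps : nat := \sum_(l < n.+1) (if eps l then l.+1 else 0)%N.

Lemma weight_flip eps : eps ord0 -> (weight (flip_sgn eps) < weight eps)%N.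
Proof.
move=> e0; rewrite /weight (bigD1 ord0) //= [ltnRHS](bigD1 ord0) //= e0 ffunE eqxx e0.
by rewrite add0n add1n ltnS; apply: leq_sum => l /negbTE l0; rewrite ffunE l0.
Qed.

(** The weight is the length of a shortest path to the all-plus sign vector, so it
drops along each of the two elementary moves towards it. *)
Lemma weight_swap eps k : eps (lo k) = false -> eps (hi k) ->
  (weight (swap_sgn k eps) < weight eps)%N.
Proof.
move=> elo ehi; rewrite /weight (reindex_inj (@perm_inj _ (sw k))) /=.
rewrite (bigD1 (hi k)) //= [ltnRHS](bigD1 (hi k)) //= ffunE tpermK ehi tpermR.
rewrite -addSn; apply: leq_add => //; apply: leq_sum => l lhi.
rewrite ffunE tpermK; case: tpermP => [->|lE|_ _] //; first by rewrite elo.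
by rewrite lE eqxx in lhi.
Qed.

Lemma first_minus eps : eps != plus_sgn ->
  exists2 l, eps l & forall j : 'I_n.+1, (j < l)%N -> eps j = false.
Proof.
move=> epsN; have [l el] : exists l, eps l.
  apply/existsP; rewrite -[X in is_true X]negbK negb_exists; apply: contraNN epsN.
  by move/forallP=> H; apply/eqP/ffunP => l; rewrite ffunE; apply/negbTE.
exists [arg min_(i < l | eps i) (i : nat)].
  by case: arg_minnP.
case: arg_minnP => // i ei mi j ji; apply/negP => /mi.
by rewrite leqNgt ji.
Qed.

Lemma first_minus_swap eps l : eps l -> (forall j : 'I_n.+1, (j < l)%N -> eps j = false) ->
  l != ord0 -> exists k, [/\ hi k = l, eps (lo k) = false & eps (hi k)].
Proof.
move=> el ml l0; have l1 : (l.-1 < n)%N.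
  by move: l0; rewrite -val_eqE /=; have := ltn_ord l; lia.
have hl : hi (Ordinal l1) = l.
  by apply: ord_inj; rewrite val_hi /= prednK // lt0n; exact: l0.
by exists (Ordinal l1); rewrite hl; split=> //; apply: ml; rewrite -{2}hl val_hi.
Qed.

(** Every sign vector is reached from the all-plus one by flipping a first entry
or moving a minus one step to the right. *)
Lemma sgn_ind (P : sgn -> Prop) :
    P plus_sgn ->
    (forall eps, eps ord0 = false -> P eps -> P (flip_sgn eps)) ->
    (forall eps k, eps (lo k) = true -> eps (hi k) = false -> P eps ->
       P (swap_sgn k eps)) ->
  forall eps, P eps.
Proof.
move=> P0 Pf Ps eps; have [m] := ubnP (weight eps); elim: m eps => // m IH eps.
rewrite ltnS => wm; have [->//|epsN] := eqVneq eps plus_sgn.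
have [l el ml] := first_minus epsN; have [l0|l0] := eqVneq l ord0.
  rewrite -[eps]flip_sgnK; apply: Pf; first by rewrite ffunE eqxx -l0 el.
  by apply: IH; apply: leq_trans wm; apply: weight_flip; rewrite -l0.
have [k [_ elo ehi]] := first_minus_swap el ml l0.
rewrite -[eps](swap_sgnK k); apply: Ps; rewrite ?swap_sgn_lo ?swap_sgn_hi //.
by apply: IH; apply: leq_trans wm; exact: weight_swap.
Qed.

End Signs.

(** * Straightening sequences *)

Section Straighten.
Variables (F : fieldType) (n : nat).
Implicit Types (k : 'I_n) (l r : 'I_n.+1) (eps : sgn n) (i j : n.+1.-tuple F).

Definition twist (b : bool) (a : F) : F := if b then a^-1 else a.

Lemma twistK b : involutive (twist b).
Proof. by case: b => a //=; rewrite invrK. Qed.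

(** The labels of the chosen strands of the unfolded diagram, from left to right:
an inverted strand is replaced by its mirror image, whose label is inverse. *)
Definition straight eps i : n.+1.-tuple F :=
  [tuple twist (eps ((pos eps)^-1%g r)) (tnth i ((pos eps)^-1%g r)) | r < n.+1].

Definition unstraight eps j : n.+1.-tuple F :=
  [tuple twist (eps l) (tnth j (pos eps l)) | l < n.+1].

Lemma tnth_straight eps i l : tnth (straight eps i) (pos eps l) = twist (eps l) (tnth i l).
Proof. by rewrite tnth_mktuple permK. Qed.

Lemma eq_straight eps i j :
  (forall l, twist (eps l) (tnth i l) = tnth j (pos eps l)) -> straight eps i = j.
Proof. by move=> ij; apply: eq_from_tnth => r; rewrite tnth_mktuple ij permKV. Qed.

Lemma unstraightK eps : cancel (unstraight eps) (straight eps).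
Proof. by move=> j; apply: eq_straight => l; rewrite tnth_mktuple twistK. Qed.

Lemma straightK eps : cancel (straight eps) (unstraight eps).
Proof.
by move=> i; apply: eq_from_tnth => l; rewrite tnth_mktuple tnth_straight twistK.
Qed.

Lemma straight_plus i : straight (plus_sgn n) i = i.
Proof. by apply: eq_straight => l; rewrite ffunE pos_plus. Qed.

Lemma straight_flip eps i : straight (flip_sgn eps) (inv_first i) = straight eps i.
Proof.
apply: eq_straight => l; rewrite pos_flip tnth_straight ffunE tnth_mktuple.
by case: ifP => // _; case: (eps l); rewrite /= ?invrK.
Qed.

Lemma tnth_swap k i l : tnth (swap_seq k i) l = tnth i (tperm (lo k) (hi k) l).
Proof. by rewrite tnth_mktuple. Qed.

Lemma swap_seqK k : involutive (@swap_seq F n k).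
Proof. by move=> i; apply: eq_from_tnth => l; rewrite !tnth_swap tpermK. Qed.

Lemma inv_firstK : involutive (@inv_first F n).
Proof.
by move=> i; apply: eq_from_tnth => l; rewrite !tnth_mktuple; case: eqP; rewrite ?invrK.
Qed.

Lemma straight_swap_same k eps i : eps (lo k) = eps (hi k) ->
  straight eps (swap_seq k i) = swap_seq (crossing eps k) (straight eps i).
Proof.
move=> E; apply: eq_straight => l.
rewrite !tnth_swap sw_crossing // tnth_straight; congr (twist _ _).
by rewrite -[in LHS](swap_sgn_id E) ffunE.
Qed.

Lemma straight_swap_mixed k eps i : eps (lo k) != eps (hi k) ->
  straight (swap_sgn k eps) (swap_seq k i) = straight eps i.
Proof.
move=> mixed; apply: eq_straight => l.
by rewrite pos_swap // tnth_straight tnth_swap ffunE.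
Qed.

End Straighten.

Section OrbitSplit.
Variables (F : fieldType) (p lam : F) (hp0 : p != 0).
Hypothesis Idisj : (Iplus p lam `&` Iminus p lam = set0)%classic.

Definition inI (x : F) : bool := `[< Iplus p lam x >].

Lemma Iminus_inv x : Iminus p lam x <-> Iplus p lam x^-1.
Proof.
split=> -[m E]; exists (- m); first by rewrite E invfM invrK mulrN invr_expz.
by rewrite -[x]invrK E invfM mulrN invr_expz.
Qed.

Lemma inI_inv x : inI x -> inI x^-1 = false.
Proof.
move=> /asboolP xp; apply/asboolP => xm.
suff : (set0 : set F) x by []. 
by rewrite -Idisj; split=> //; apply/Iminus_inv.
Qed.

(** Arrows multiply by [p ^+ 2] and hence preserve each half of the orbit. *)
Lemma inI_arrow a b : arrow p a b -> inI a = inI b.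
Proof.
move=> /eqP->; apply/asboolP/asboolP => -[m E].
  exists (m - 1); apply: (mulfI (expf_neq0 2 hp0)); rewrite E mulrA exprnP -expfzDr //.
  by congr (p ^ _ * _); lia.
exists (m + 1); rewrite E mulrA exprnP -expfzDr //.
by congr (p ^ _ * _); lia.
Qed.

(** Two entries of different signs lie in different halves of the orbit, between
which there are no arrows. *)
Lemma twist_mixed b c x y : b != c -> inI (twist b x) -> inI (twist c y) ->
  [/\ (x == y) = false, arrow p x y = false & arrow p y x = false].
Proof.
have main s t : inI s -> inI t^-1 ->
    [/\ (s == t) = false, arrow p s t = false & arrow p t s = false].
  move=> Is /inI_inv; rewrite invrK => It; split; apply/negP;
    [move/eqP=> E | move/inI_arrow=> E | move/inI_arrow/esym=> E];
    by rewrite E It in Is.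
case: b; case: c => //= _ Ix Iy; last exact: main.
by have [A B C] := main _ _ Iy Ix; rewrite eq_sym.
Qed.

Variable nu : {mset F}%mset.
Hypothesis hnu : thetaN (Iorbit p lam) nu.
Local Notation tnu := (mset_restrict (Iplus p lam) nu).

Lemma mset_restrictE x : tnu x = if inI x then nu x else 0%N.
Proof.
rewrite fsfunE; case: ifPn => //; rewrite mem_finsupp negbK => /eqP->.
by rewrite if_same.
Qed.

Lemma count_inv (s : seq F) x : count_mem x [seq y^-1 | y <- s] = count_mem x^-1 s.
Proof. by rewrite count_map; apply: eq_count => y /=; rewrite (can2_eq invrK invrK). Qed.

Lemma nu_outside x : ~~ inI x -> ~~ inI x^-1 -> nu x = 0%N.
Proof.
move=> Ix Iy; apply/eqP; apply: contraTT isT => nux.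
have [] : Iorbit p lam x by apply: hnu.1; rewrite in_mset lt0n.
  by move=> /asboolP; rewrite -[asbool _]/(inI x) (negbTE Ix).
by move=> /Iminus_inv/asboolP; rewrite -[asbool _]/(inI _) (negbTE Iy).
Qed.

(** The two halves of the orbit are disjoint and exchanged by inversion, so each
multiplicity of [nu] is seen by exactly one of the two summands. *)
Lemma restrict_double (s : seq F) : {in s, forall x, inI x} ->
  (seq_mset s == tnu) =
  ((seq_mset s `+` seq_mset [seq x^-1 | x <- s])%mset == nu).
Proof.
move=> Is; have s0 x : ~~ inI x -> count_mem x s = 0%N.
  by move=> Ix; apply/count_memPn; apply: contraNN Ix => /Is.
apply/eqP/eqP => E; apply/msetP => x.
  rewrite msetE2 !mset_seqE count_inv -!mset_seqE E !mset_restrictE.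
  case: ifPn => [Ix|Ix]; first by rewrite inI_inv ?addn0.
  by case: ifPn => [_|Iy]; [rewrite -hnu.2 | rewrite nu_outside].
have nuE y : nu y = (count_mem y s + count_mem y^-1 s)%N.
  by rewrite -E msetE2 !mset_seqE count_inv.
rewrite mset_restrictE mset_seqE nuE; case: ifPn => [Ix|/s0 //].
by rewrite (s0 x^-1) ?addn0 // inI_inv.
Qed.

Lemma restrict_inI (s : seq F) : seq_mset s == tnu -> {in s, forall x, inI x}.
Proof.
move=> /eqP E x xs; apply: contraT => Ix.
have := mset_restrictE x; rewrite -E mset_seqE (negbTE Ix) => /count_memPn.
by rewrite xs.
Qed.

(** Listing the elements of the restriction together with their inverses lists
[nu]. *)
Lemma size_restrict : (size nu)./2 = size tnu.
Proof.
set s : seq F := tnu.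
have sE : seq_mset s == tnu by rewrite /s seq_mset_id.
have := sE; rewrite restrict_double; last exact: restrict_inI.
move=> /eqP <-; have -> : (seq_mset s `+` seq_mset [seq x^-1 | x <- s])%mset =
    seq_mset (s ++ [seq x^-1 | x <- s]).
  by apply/msetP => x; rewrite msetE2 !mset_seqE count_cat.
by rewrite (perm_size (perm_eq_seq_mset _)) size_cat size_map addnn doubleK.
Qed.

Variable n : nat.
Implicit Types (eps : sgn n) (i j : n.+1.-tuple F).

Lemma klr_inI j l : klr_seq tnu j -> inI (tnth j l).
Proof. by move=> /restrict_inI; apply; exact: mem_tnth. Qed.

(** Permuting the entries and inverting some of them does not change the multiset
of the entries together with their inverses. *)
Lemma theta_straight eps i : theta_seq nu (straight eps i) = theta_seq nu i.
Proof.
congr (_ == nu); apply/msetP => x; rewrite !msetE2 !mset_seqE !count_inv.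
have cE (t : n.+1.-tuple F) y : count_mem y t = (\sum_l (tnth t l == y))%N.
  by rewrite -sum1_count big_tuple big_mkcond; apply: eq_bigr => l _ /=; case: eqP.
rewrite !cE -!big_split /= (reindex_inj (@perm_inj _ (pos eps))).
apply: eq_bigr => l _; rewrite tnth_straight; case: (eps l) => //=.
by rewrite (inj_eq invr_inj) (can2_eq invrK invrK) addnC.
Qed.

Lemma klr_straight eps i : klr_seq tnu (straight eps i) =
  theta_seq nu i && [forall l, inI (twist (eps l) (tnth i l))].
Proof.
apply/idP/andP => [ki|[ti /forallP Ii]].
  split; last by apply/forallP => l; rewrite -tnth_straight klr_inI.
  rewrite -(theta_straight eps) /theta_seq -restrict_double //; exact: restrict_inI.
rewrite /klr_seq restrict_double; first by rewrite -[_ == _]/(theta_seq _ _) theta_straight.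
by move=> x /tnthP[r ->]; rewrite tnth_mktuple.
Qed.

Lemma klr_theta j : klr_seq tnu j -> theta_seq nu j.
Proof. by rewrite -{1}(straight_plus j) klr_straight => /andP[]. Qed.

Lemma straight_exists i : theta_seq nu i -> exists eps, klr_seq tnu (straight eps i).
Proof.
move=> ti; exists [ffun l => ~~ inI (tnth i l)]; rewrite klr_straight ti.
apply/forallP => l; rewrite ffunE /twist; case: ifPn => [Ix|]; last by rewrite negbK.
have : Iorbit p lam (tnth i l).
  apply: hnu.1; have := theta_seq_supp ti (mem_tnth l i).
  by rewrite mem_finsupp -lt0n -in_mset.
by case=> [/asboolP|/Iminus_inv/asboolP //]; rewrite -[asbool _]/(inI _) (negbTE Ix).
Qed.

Lemma straight_unique i eps eps' :
  klr_seq tnu (straight eps i) -> klr_seq tnu (straight eps' i) -> eps = eps'.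
Proof.
rewrite !klr_straight => /andP[_ /forallP I1] /andP[_ /forallP I2].
apply/ffunP => l; have := I1 l; have := I2 l.
by case: (eps l); case: (eps' l) => //= A B;
  [rewrite (inI_inv A) in B | rewrite (inI_inv B) in A].
Qed.

End OrbitSplit.

(** * The KLR relations in an arbitrary ring *)

Section KlrLaws.
Variables (F : fieldType) (p : F) (n : nat).

Definition quad_val (A : pzRingType) (a b : F) (xl xh : A) : A :=
  if a == b then 0
  else if arrow_both p a b then (xh - xl) * (xl - xh)
  else if arrow_to p a b then xl - xh
  else if arrow_to p b a then xh - xl
  else 1.

Definition braid_val (A : pzRingType) (a b c : F) (x1 x2 x3 : A) : A :=
  if a != c then 0
  else if arrow_to p a b then 1
  else if arrow_to p b a then - 1
  else if arrow_both p a b then x2 *+ 2 - x3 - x1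
  else 0.

Definition sx_val (A : pzRingType) (a b : F) (isl ish : bool) : A :=
  if (a == b) && isl then - 1 else if (a == b) && ish then 1 else 0.

(** The KLR relations for elements of any ring, with an idempotent for every
sequence, possibly zero. This form serves for the KLR algebra, the VV algebra,
the matrix model and the corner alike. *)
Record klr_laws (A : pzRingType) (X : 'I_n.+1 -> A) (S : 'I_n -> A)
    (E : n.+1.-tuple F -> A) : Prop := KlrLaws {
  law_ee : forall i j, E i * E j = if i == j then E i else 0;
  law_se : forall k i, S k * E i = E (swap_seq k i) * S k;
  law_xe : forall l i, X l * E i = E i * X l;
  law_xx : forall l l', X l * X l' = X l' * X l;
  law_quad : forall k i, S k * S k * E i =
    quad_val (tnth i (lo k)) (tnth i (hi k)) (X (lo k)) (X (hi k)) * E i;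
  law_ss : forall j k : 'I_n, (j.+1 < k)%N || (k.+1 < j)%N -> S j * S k = S k * S j;
  law_braid : forall (k k' : 'I_n) i, k' = k.+1 :> nat ->
    (S k' * S k * S k' - S k * S k' * S k) * E i =
    braid_val (tnth i (lo k)) (tnth i (hi k)) (tnth i (hi k'))
      (X (lo k)) (X (hi k)) (X (hi k')) * E i;
  law_sx : forall k l i, (S k * X l - X (tperm (lo k) (hi k) l) * S k) * E i =
    sx_val A (tnth i (lo k)) (tnth i (hi k)) (l == lo k) (l == hi k) * E i }.

Section Presented.
Variables (A : kalg F) (T : Type) (J : finType) (seq_of : J -> n.+1.-tuple F).
Variables (x : 'I_n.+1 -> aexpr F T) (s : 'I_n -> aexpr F T) (e : J -> aexpr F T).
Variable f : T -> A.
Local Notation ev := (teval f).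

Lemma teval_quad k a b : ev (quad_coef p x k a b) =
  quad_val a b (ev (x (lo k))) (ev (x (hi k))).
Proof.
rewrite /quad_coef /quad_val.
by do !case: ifP => _; rewrite /= ?rmorph0 ?rmorph1 ?rmorphN1 ?mulN1r.
Qed.

Lemma teval_braid k k' a b c : ev (braid_coef p x k k' a b c) =
  braid_val a b c (ev (x (lo k))) (ev (x (hi k))) (ev (x (hi k'))).
Proof.
rewrite /braid_coef /braid_val.
by do !case: ifP => _; rewrite /= ?rmorph0 ?rmorph1 ?rmorphN1 ?mulN1r // ?mulr1
   rmorph_nat mulr_natl.
Qed.

Lemma teval_sx (k : 'I_n) (l : 'I_n.+1) a b :
  ev (sx_coef T k l a b) = sx_val A a b (l == lo k) (l == hi k).
Proof.
rewrite /sx_coef /sx_val.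
by do !case: ifP => _; rewrite /= ?rmorph0 ?rmorph1 ?rmorphN1 ?mulN1r.
Qed.

Lemma teval_sum (I : finType) (g : I -> aexpr F T) :
  ev (\big[@TAdd F T/TCst 0]_i g i) = \sum_i ev (g i).
Proof. by elim/big_rec2: _ => [|i a b _ <-] //=; exact: rmorph0. Qed.

(** With [klr_presented_laws], this translates between the relations of a
presentation and relations between elements of a ring. *)
Lemma klr_rel_of_laws X S E :
    (forall l, ev (x l) = X l) -> (forall k, ev (s k) = S k) ->
    (forall i, ev (e i) = E (seq_of i)) ->
    injective seq_of -> klr_laws X S E -> \sum_j E (seq_of j) = 1 ->
  forall t u, klr_rel p seq_of x s e t u -> ev t = ev u.
Proof.
move=> xE sE eE seqI L sum1 t u; case.
- move=> i j; rewrite /= !eE (law_ee L) (inj_eq seqI).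
  by case: eqP => // _; rewrite /= rmorph0.
- by move=> k i j ij; rewrite /= sE !eE (law_se L) ij.
- by move=> l i; rewrite /= xE eE (law_xe L).
- by rewrite teval_sum /= rmorph1 -sum1; apply: eq_bigr => j _; rewrite eE.
- by move=> l l'; rewrite /= !xE (law_xx L).
- by move=> k i; rewrite /= sE eE teval_quad !xE (law_quad L).
- by move=> j k jk; rewrite /= !sE (law_ss L).
- move=> k k' i kk'; rewrite /= teval_braid !sE !xE eE rmorphN1 mulN1r.
  exact: (law_braid L).
- move=> k l i; rewrite /= teval_sx !sE !xE eE rmorphN1 mulN1r.
  exact: (law_sx L).
Qed.

Variable P : pred (n.+1.-tuple F).
Hypotheses (seqI : injective seq_of) (seqP : forall j, P (seq_of j)).
Hypothesis Pseq : forall i, P i -> exists j, seq_of j = i.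
Hypothesis Pswap : forall k i, P (swap_seq k i) = P i.
Hypothesis frel : forall t u, klr_rel p seq_of x s e t u -> ev t = ev u.

(** The idempotents are indexed by all sequences, those outside [P] being zero,
so that swapping entries needs no membership proof. *)
Definition idem (i : n.+1.-tuple F) : A := \sum_(j | seq_of j == i) ev (e j).

Lemma idem_seq j : idem (seq_of j) = ev (e j).
Proof. by rewrite /idem (eq_bigl (pred1 j)) ?big_pred1_eq // => j'; exact: inj_eq. Qed.

Lemma idem_out i : ~~ P i -> idem i = 0.
Proof. by move=> Pi; apply: big1 => j /eqP ij; rewrite -ij seqP in Pi. Qed.

Lemma idem_sum1 : \sum_j idem (seq_of j) = 1.
Proof.
under eq_bigr do rewrite idem_seq.
by rewrite -teval_sum (frel (klr_sum1 _ _ _ _ _)) /= rmorph1.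
Qed.

Lemma idem_cases i : idem i = 0 \/ exists2 j, seq_of j = i & idem i = ev (e j).
Proof.
have [/Pseq[j <-]|/idem_out] := boolP (P i); last by left.
by right; exists j; rewrite ?idem_seq.
Qed.

Lemma klr_presented_laws :
  klr_laws (fun l => ev (x l)) (fun k => ev (s k)) idem.
Proof.
split.
- move=> i j; case: (idem_cases i) => [->|[i' <- ->]].
    by rewrite mul0r if_same.
  case: (idem_cases j) => [j0|[j' <- ->]].
    rewrite j0 mulr0; case: eqP => // ij.
    by rewrite -idem_seq ij j0.
  by rewrite (inj_eq seqI) [LHS](frel (klr_ee _ _ _ _ _ i' j')); case: eqP => //= _; rewrite rmorph0.
- move=> k i; have [Pi|Pi] := boolP (P i); last first.
    by rewrite !idem_out ?Pswap // mulr0 mul0r.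
  have [i' <-] := Pseq Pi; have [j' ij] := Pseq (etrans (Pswap k _) (seqP i')).
  by rewrite -ij !idem_seq [LHS](frel (klr_se _ _ _ _ ij)).
- move=> l i; case: (idem_cases i) => [->|[i' <- ->]]; first by rewrite mulr0 mul0r.
  by rewrite [LHS](frel (klr_xe _ _ _ _ _ l i')).
- by move=> l l'; rewrite [LHS](frel (klr_xx _ _ _ _ _ l l')).
- move=> k i; case: (idem_cases i) => [->|[i' <- ->]]; first by rewrite !mulr0.
  by rewrite [LHS](frel (klr_quad _ _ _ _ _ k i')) /= teval_quad.
- by move=> j k jk; rewrite [LHS](frel (klr_ss _ _ _ _ _ jk)).
- move=> k k' i kk'; case: (idem_cases i) => [->|[i' <- ->]]; first by rewrite !mulr0.
  have := frel (klr_braid _ _ _ _ _ i' kk').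
  by rewrite /= teval_braid rmorphN1 mulN1r.
- move=> k l i; case: (idem_cases i) => [->|[i' <- ->]]; first by rewrite !mulr0.
  have := frel (klr_sx _ _ _ _ _ k l i').
  by rewrite /= teval_sx rmorphN1 mulN1r.
Qed.

End Presented.
End KlrLaws.

(** * The VV relations in an arbitrary ring *)

Section SwapInvariance.
Variables (F : fieldType) (n : nat) (nu : {mset F}%mset).
Implicit Types (k : 'I_n) (i : n.+1.-tuple F).

Lemma perm_swap_seq k i : perm_eq (swap_seq k i) i.
Proof. by apply/tuple_permP; exists (tperm (lo k) (hi k)). Qed.

Lemma klr_swap k i : klr_seq nu (swap_seq k i) = klr_seq nu i.
Proof. by congr (_ == _); apply/eq_seq_msetP; exact: perm_swap_seq. Qed.

Lemma theta_swap k i : theta_seq nu (swap_seq k i) = theta_seq nu i.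
Proof.
have /eq_seq_msetP E := perm_swap_seq k i.
have /eq_seq_msetP E' := perm_map (fun x : F => x^-1) (perm_swap_seq k i).
by rewrite /theta_seq E E'.
Qed.

End SwapInvariance.

Section VVLaws.
Variables (F : fieldType) (p : F) (n : nat).

(** As neither [q] nor its inverse is an entry of a sequence, the reflection is an
involution and the braid relation of type B has no correction term. *)
Record vv_laws (A : pzRingType) (X : 'I_n.+1 -> A) (S : 'I_n -> A)
    (E : n.+1.-tuple F -> A) (Pi : A) : Prop := VVLaws {
  law_klr : klr_laws p X S E;
  law_pie : forall i, Pi * E i = E (inv_first i) * Pi;
  law_pipi : Pi * Pi = 1;
  law_pix0 : Pi * X ord0 = - (X ord0 * Pi);
  law_pix : forall l, l != ord0 -> Pi * X l = X l * Pi;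
  law_spi : forall k : 'I_n, k = 0%N :> nat ->
    S k * Pi * (S k * Pi) = Pi * S k * (Pi * S k);
  law_pis : forall k : 'I_n, k != 0%N :> nat -> Pi * S k = S k * Pi }.

Variables (q lam : F) (nu : {mset F}%mset).
Hypotheses (hp0 : p != 0) (hqI : ~ Iorbit p lam q).
Hypothesis Idisj : (Iplus p lam `&` Iminus p lam = set0)%classic.
Hypothesis hnu : thetaN (Iorbit p lam) nu.
Local Notation tnu := (mset_restrict (Iplus p lam) nu).

Lemma theta_inv_first (i : n.+1.-tuple F) :
  theta_seq nu (inv_first i) = theta_seq nu i.
Proof.
by rewrite -(theta_straight _ (flip_sgn (plus_sgn n))) straight_flip theta_straight.
Qed.

(** The orbit is stable under inversion, so it does not contain the inverse of [q]
either. *)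
Lemma theta_entry_neq_q (i : n.+1.-tuple F) l : theta_seq nu i ->
  (tnth i l == q) = false /\ (tnth i l == q^-1) = false.
Proof.
move=> ti; have : Iorbit p lam (tnth i l).
  apply: hnu.1; have := theta_seq_supp ti (mem_tnth l i).
  by rewrite mem_finsupp -lt0n -in_mset.
move=> Il; split; apply/eqP => E; apply: hqI; first by rewrite -E.
have {}E : (tnth i l)^-1 = q by rewrite E invrK.
case: Il => [Ip|/Iminus_inv]; last by rewrite E; left.
by right; apply/Iminus_inv; rewrite -E invrK.
Qed.

Local Notation vv_seq := (val : theta_idx n.+1 nu -> n.+1.-tuple F).
Local Notation klr_tuple := (val : klr_idx n.+1 tnu -> n.+1.-tuple F).

Lemma theta_idx_of (i : n.+1.-tuple F) : theta_seq nu i -> exists j, vv_seq j = i.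
Proof. by move=> ti; exists (Sub i ti); exact: SubK. Qed.

Lemma klr_idx_of (i : n.+1.-tuple F) : klr_seq tnu i -> exists j, klr_tuple j = i.
Proof. by move=> ti; exists (Sub i ti); exact: SubK. Qed.

Section Presented.
Variables (A : kalg F) (f : vv_gen n nu -> A).
Hypothesis frel : forall s t, vv_rel p q s t -> teval f s = teval f t.

Definition vv_idem : n.+1.-tuple F -> A :=
  idem vv_seq (fun i => TVar (VE i)) f.

Lemma vv_presented_laws :
  vv_laws (fun l => f (VX nu l)) (fun k => f (VS nu k)) vv_idem (f (VPi n nu)).
Proof.
have klrel t u (r : klr_rel p vv_seq (fun l => TVar (VX nu l)) (fun k => TVar (VS nu k))
    (fun i => TVar (VE i)) t u) := frel (vv_klr q r).
have vvI : injective vv_seq by exact: val_inj.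
have vvP j : theta_seq nu (vv_seq j) by exact: valP.
have K := klr_presented_laws vvI vvP theta_idx_of (@theta_swap F n nu) klrel.
have sum1 := idem_sum1 vvI klrel.
have ext a b : (forall j : theta_idx n.+1 nu, a * vv_idem (val j) = b * vv_idem (val j)) ->
    a = b.
  by move=> ab; rewrite -[a]mulr1 -[b]mulr1 -sum1 !mulr_sumr; apply: eq_bigr.
have iE (j : theta_idx n.+1 nu) : vv_idem (val j) = f (VE j).
  by rewrite [LHS]idem_seq //; exact: val_inj.
split=> //.
- move=> i; have [ti|ti] := boolP (theta_seq nu i); last first.
    by rewrite /vv_idem !(idem_out _ _ vvP) ?theta_inv_first ?mulr0 ?mul0r.
  have [i' <-] := theta_idx_of ti.
  have [j' ij] := theta_idx_of (etrans (theta_inv_first _) (valP i')).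
  by rewrite -ij !iE [LHS](frel (vv_pie _ _ ij)).
- apply: ext => j; rewrite iE; have := frel (@vv_pipi F p n q nu j).
  have [q1 q2] := theta_entry_neq_q ord0 (valP j).
  by rewrite /pi_coef q1 q2 /= rmorph1.
- by have := frel (@vv_pix0 F p n q nu); rewrite /= rmorphN1 mulN1r.
- by move=> l l0; have := frel (@vv_pix F p n q nu l l0).
- move=> k k0; apply: ext => j; rewrite iE; have := frel (@vv_spi F p n q nu k j k0).
  have [q1 q2] := theta_entry_neq_q (hi k) (valP j).
  rewrite /spi_coef q1 q2 !andbF /= rmorph0 mul0r rmorphN1 mulN1r.
  by move/eqP; rewrite subr_eq0 => /eqP.
- by move=> k k0; have := frel (@vv_pis F p n q nu k k0).
Qed.
End Presented.

Lemma vv_rel_of_laws (A : kalg F) X S E Pi (f : vv_gen n nu -> A) :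
    (forall l, f (VX nu l) = X l) -> (forall k, f (VS nu k) = S k) ->
    (forall i, f (VE i) = E (val i)) -> f (VPi n nu) = Pi ->
    vv_laws X S E Pi -> \sum_(j : theta_idx n.+1 nu) E (val j) = 1 ->
  forall s t, vv_rel p q s t -> teval f s = teval f t.
Proof.
move=> fX fS fE fPi L sum1 s t; case.
- move=> {}s {}t; apply: (klr_rel_of_laws (X := X) (S := S) (E := E)) => //.
    exact: val_inj.
  exact: law_klr L.
- by move=> i j ij; rewrite /= fPi !fE (law_pie L) ij.
- move=> i; have [q1 q2] := theta_entry_neq_q ord0 (valP i).
  by rewrite /pi_coef q1 q2 /= rmorph1 fPi (law_pipi L).
- by rewrite /= fPi fX rmorphN1 mulN1r (law_pix0 L).
- by move=> l l0; rewrite /= fPi fX (law_pix L).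
- move=> k i k0; have [q1 q2] := theta_entry_neq_q (hi k) (valP i).
  rewrite /spi_coef q1 q2 !andbF /= rmorph0 mul0r rmorphN1 mulN1r fPi fS.
  by rewrite (law_spi L) // subrr.
- by move=> k k0; rewrite /= fPi fS (law_pis L).
Qed.

End VVLaws.

(** * The matrix model *)

Section LocalValues.
Variables (F : fieldType) (p : F) (hp0 : p != 0).

Lemma arrow_inv (a b : F) : arrow p a^-1 b^-1 = arrow p b a.
Proof.
have p20 := expf_neq0 2 hp0; rewrite /arrow; apply/eqP/eqP => [H|->].
  by rewrite -[b]invrK -[a]invrK H invfM !invrK mulrA divff ?mul1r.
by rewrite invfM mulrA divff ?mul1r.
Qed.

Lemma arrow_to_inv (a b : F) : arrow_to p a^-1 b^-1 = arrow_to p b a.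
Proof. by rewrite /arrow_to !arrow_inv. Qed.

Lemma arrow_both_inv (a b : F) : arrow_both p a^-1 b^-1 = arrow_both p b a.
Proof. by rewrite /arrow_both !arrow_inv. Qed.

Variable A : pzRingType.

Definition signed (b : bool) (x : A) : A := if b then - x else x.

(** Inverting the entries reverses the arrows, which is compensated by the
signs of the variables and the reversal of their order. *)
Lemma quad_val_twist b x y (xl xh : A) :
  quad_val p (twist b x) (twist b y) (signed b xl) (signed b xh) =
  if b then quad_val p y x xh xl else quad_val p x y xl xh.
Proof.
case: b => //=; rewrite /quad_val (inj_eq invr_inj) [x == y]eq_sym.
rewrite !arrow_to_inv arrow_both_inv.
by do !case: ifP => _; rewrite // !opprK ![- _ + _]addrC.
Qed.

Lemma braid_val_twist b x y z (x1 x2 x3 : A) :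
  braid_val p (twist b x) (twist b y) (twist b z) (signed b x1) (signed b x2) (signed b x3) =
  if b then - braid_val p z y x x3 x2 x1 else braid_val p x y z x1 x2 x3.
Proof.
case: b => //=; rewrite /braid_val (inj_eq invr_inj) [z == x]eq_sym.
case: (eqVneq x z) => [<-|_]; last by rewrite oppr0.
rewrite !arrow_to_inv arrow_both_inv /arrow_to /arrow_both [arrow p x y && _]andbC.
case: (arrow p x y); case: (arrow p y x); rewrite //= ?oppr0 ?opprK //.
by rewrite !mulr2n -opprD !opprB [- _ + x3]addrC -addrA [- _ + x1]addrC.
Qed.

Lemma sx_val_twist b (x y : F) isl ish : isl && ish = false ->
  sx_val A (twist b x) (twist b y) isl ish =
  if b then - sx_val A y x ish isl else sx_val A x y isl ish.
Proof.
case: b => //= H; rewrite /sx_val (inj_eq invr_inj) [y == x]eq_sym.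
by case: eqP => _; move: H; case: isl; case: ish => //= _; rewrite ?oppr0 ?opprK.
Qed.
End LocalValues.

Section MixedValues.
Variables (F : fieldType) (p lam : F) (n : nat) (nu : {mset F}%mset).
Hypothesis hp0 : p != 0.
Hypothesis Idisj : (Iplus p lam `&` Iminus p lam = set0)%classic.
Local Notation tnu := (mset_restrict (Iplus p lam) nu).
Variables (eps : sgn n) (i : n.+1.-tuple F).
Hypothesis ki : klr_seq tnu (straight eps i).
Implicit Types (k : 'I_n).

Lemma mixed_entries l l' : eps l != eps l' ->
  [/\ (tnth i l == tnth i l') = false, arrow p (tnth i l) (tnth i l') = false
    & arrow p (tnth i l') (tnth i l) = false].
Proof.
by move=> mixed; apply: (twist_mixed hp0 Idisj mixed); rewrite -tnth_straight;
  apply: klr_inI ki.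
Qed.

Variable A : pzRingType.

Lemma quad_val_mixed k (xl xh : A) : eps (lo k) != eps (hi k) ->
  quad_val p (tnth i (lo k)) (tnth i (hi k)) xl xh = 1.
Proof.
by move=> /mixed_entries[A1 A2 A3]; rewrite /quad_val /arrow_both /arrow_to A1 A2 A3.
Qed.

Lemma sx_val_mixed k isl ish : eps (lo k) != eps (hi k) ->
  sx_val A (tnth i (lo k)) (tnth i (hi k)) isl ish = 0.
Proof. by move=> /mixed_entries[A1 _ _]; rewrite /sx_val A1. Qed.

Lemma braid_val_mixed (k k' : 'I_n) (x1 x2 x3 : A) :
    ~~ ((eps (lo k) == eps (hi k)) && (eps (hi k) == eps (hi k'))) ->
  braid_val p (tnth i (lo k)) (tnth i (hi k)) (tnth i (hi k')) x1 x2 x3 = 0.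
Proof.
rewrite negb_and /braid_val /arrow_to /arrow_both => /orP[] /mixed_entries[_ A1 A2].
  by rewrite A1 A2 if_same.
by case: eqP => //= ->; rewrite A1 A2.
Qed.
End MixedValues.

Section MatrixModel.
Variables (F : fieldType) (p lam : F) (n : nat) (nu : {mset F}%mset).
Hypothesis hp0 : p != 0.
Hypothesis Idisj : (Iplus p lam `&` Iminus p lam = set0)%classic.
Hypothesis hnu : thetaN (Iorbit p lam) nu.
Local Notation tnu := (mset_restrict (Iplus p lam) nu).
Variables (B : kalg F) (X : 'I_n.+1 -> B) (S : 'I_n -> B) (E : n.+1.-tuple F -> B).
Hypothesis L : klr_laws p X S E.
Hypothesis Eout : forall i, ~~ klr_seq tnu i -> E i = 0.
Implicit Types (k : 'I_n) (l r : 'I_n.+1) (eps : sgn n) (i j : n.+1.-tuple F).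

Local Notation signed := (@signed B).
(** The coefficient by which [X l] acts on the summand of [eps]; it changes sign
with the strand because the reflection negates the first variable. *)
Definition x_coef eps l : B := signed (eps l) (X (pos eps l)).
(** A mixed crossing moves between two summands without acting on the straightened
diagram. *)
Definition s_coef eps k : B :=
  if eps (lo k) == eps (hi k) then S (crossing eps k) else 1.

Local Notation MS := (mx_alg B #|sgn n|).
Definition mX l : MS := mono id (fun eps => x_coef eps l).
Definition mS k : MS := mono (swap_sgn k) (fun eps => s_coef eps k).
Definition mE i : MS := mono id (fun eps => E (straight eps i)).
Definition mPi : MS := mono (@flip_sgn n) (fun=> 1).

Lemma signedD b x y : signed b x + signed b y = signed b (x + y).
Proof. by case: b => //=; rewrite opprD. Qed.
Lemma signed_mull b x y : signed b x * y = signed b (x * y).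
Proof. by case: b => //=; rewrite mulNr. Qed.
Lemma signed_mulr b x y : y * signed b x = signed b (y * x).
Proof. by case: b => //=; rewrite mulrN. Qed.
Lemma signedN b x : signed (~~ b) x = - signed b x.
Proof. by case: b => //=; rewrite opprK. Qed.
Lemma signed_opp b x : - signed b x = signed b (- x).
Proof. by case: b. Qed.

Lemma x_coef_flip eps l :
  x_coef (flip_sgn eps) l = if l == ord0 then - x_coef eps l else x_coef eps l.
Proof. by rewrite /x_coef pos_flip ffunE; case: ifP; rewrite ?signedN. Qed.

Lemma x_coef_swap eps k l : eps (lo k) != eps (hi k) ->
  x_coef (swap_sgn k eps) (tperm (lo k) (hi k) l) = x_coef eps l.
Proof. by move=> mixed; rewrite /x_coef pos_swap // ffunE tpermK. Qed.

Lemma s_coef_same eps k : eps (lo k) = eps (hi k) -> s_coef eps k = S (crossing eps k).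
Proof. by rewrite /s_coef => ->; rewrite eqxx. Qed.
Lemma s_coef_mixed eps k : eps (lo k) != eps (hi k) -> s_coef eps k = 1.
Proof. by rewrite /s_coef => /negbTE->. Qed.

Lemma s_coef_flip eps k : k != 0%N :> nat -> s_coef (flip_sgn eps) k = s_coef eps k.
Proof.
move=> k0; rewrite /s_coef crossing_flip !ffunE -!val_eqE /=.
by rewrite (negbTE k0).
Qed.

Lemma s_coef_far eps k (j : 'I_n) : (k.+1 < j)%N || (j.+1 < k)%N ->
  s_coef (swap_sgn k eps) j = s_coef eps j.
Proof. by move=> far; rewrite /s_coef crossing_far // !swap_sgn_lo_far. Qed.

Lemma E_cases eps i : E (straight eps i) = 0 \/ klr_seq tnu (straight eps i).
Proof. by have [ki|/Eout] := boolP (klr_seq tnu (straight eps i)); [right|left]. Qed.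

Lemma mE_ee i j : mE i * mE j = if i == j then mE i else 0.
Proof.
rewrite monoM -[0](mono0 (S := sgn n) B id) -[LHS]/(mono id _).
have -> : (if i == j then mE i else mono id (fun=> 0)) =
    mono id (fun eps => if i == j then E (straight eps i) else 0) :> MS by case: eqP.
apply: mono_eq => // eps; rewrite (law_ee L) (inj_eq (can_inj (straightK eps))).
by case: eqP => // ->.
Qed.

Lemma mE_se k i : mS k * mE i = mE (swap_seq k i) * mS k.
Proof.
rewrite !monoM; apply: mono_eq => // eps.
have [same|mixed] := eqVneq (eps (lo k)) (eps (hi k)).
  by rewrite s_coef_same // swap_sgn_id // (law_se L) straight_swap_same.
by rewrite s_coef_mixed // straight_swap_mixed // mulr1 mul1r.
Qed.

Lemma mE_xe l i : mX l * mE i = mE i * mX l.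
Proof.
rewrite !monoM; apply: mono_eq => // eps.
by rewrite signed_mull signed_mulr (law_xe L).
Qed.

Lemma mX_comm l l' : mX l * mX l' = mX l' * mX l.
Proof.
rewrite !monoM; apply: mono_eq => // eps.
by rewrite !signed_mull !signed_mulr (law_xx L); case: (eps l); case: (eps l').
Qed.

Lemma mono_quad a b (x y : sgn n -> B) :
  quad_val p a b (mono id x : MS) (mono id y) =
  mono id (fun eps => quad_val p a b (x eps) (y eps)).
Proof.
rewrite /quad_val; do !case: ifP => _;
by rewrite ?mono0 ?mono1 ?monoN ?monoD ?monoM.
Qed.

Lemma mono_braid a b c (x y z : sgn n -> B) :
  braid_val p a b c (mono id x : MS) (mono id y) (mono id z) =
  mono id (fun eps => braid_val p a b c (x eps) (y eps) (z eps)).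
Proof.
rewrite /braid_val; do !case: ifP => _;
rewrite ?mono0 ?mono1 -?(mono1 B (sgn n)) ?mulr2n ?monoN ?monoD //.
Qed.

Lemma mono_sx (a b : F) isl ish :
  sx_val MS a b isl ish = mono id (fun=> sx_val B a b isl ish).
Proof.
by rewrite /sx_val; do !case: ifP => _; rewrite ?mono0 -?(mono1 B (sgn n)) ?monoN.
Qed.

Lemma mE_quad k i : mS k * mS k * mE i =
  quad_val p (tnth i (lo k)) (tnth i (hi k)) (mX (lo k)) (mX (hi k)) * mE i.
Proof.
rewrite mono_quad !monoM; apply: mono_eq => [eps|eps _]; last by rewrite swap_sgnK.
have [same|mixed] := eqVneq (eps (lo k)) (eps (hi k)).
  rewrite swap_sgn_id // s_coef_same // (law_quad L).
  rewrite -[tnth i (lo k)](twistK (eps (lo k))) -[tnth i (hi k)](twistK (eps (hi k))).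
  rewrite -!tnth_straight /x_coef -same quad_val_twist //.
  by have := crossing_lohi same; case: ifP => _ [-> ->].
have mixed' : swap_sgn k eps (lo k) != swap_sgn k eps (hi k).
  by rewrite swap_sgn_lo swap_sgn_hi eq_sym.
rewrite (s_coef_mixed mixed) (s_coef_mixed mixed') !mul1r.
have [->|ki] := E_cases eps i; first by rewrite mulr0.
by rewrite (quad_val_mixed hp0 Idisj ki) // mul1r.
Qed.

Lemma mS_far (j k : 'I_n) : (j.+1 < k)%N || (k.+1 < j)%N -> mS j * mS k = mS k * mS j.
Proof.
move=> far; rewrite !monoM; apply: mono_eq => [eps|eps _]; last exact: swap_sgn_far.
have far' : (k.+1 < j)%N || (j.+1 < k)%N by rewrite orbC.
rewrite !s_coef_far //; have [Ej|Ej] := eqVneq (eps (lo j)) (eps (hi j)); last first.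
  by rewrite (s_coef_mixed Ej) mul1r mulr1.
have [Ek|Ek] := eqVneq (eps (lo k)) (eps (hi k)); last first.
  by rewrite (s_coef_mixed Ek) mul1r mulr1.
by rewrite !s_coef_same // (law_ss L) // crossing_far_far.
Qed.

Section Adjacent.
Variables (k k' : 'I_n) (kk' : k' = k.+1 :> nat).
(** When the three strands do not all have the same sign, exactly one of the three
crossings on each side survives straightening, that of the same two strands. *)
Lemma s_coef_braid eps :
    ~~ ((eps (lo k) == eps (hi k)) && (eps (hi k) == eps (hi k'))) ->
  s_coef (swap_sgn k (swap_sgn k' eps)) k' * s_coef (swap_sgn k' eps) k * s_coef eps k' =
  s_coef (swap_sgn k' (swap_sgn k eps)) k * s_coef (swap_sgn k eps) k' * s_coef eps k.
Proof.
have [H1 H2 H3] := crossing_adj kk' eps.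
have lk := lo_succ kk'; have ska := sw_adj kk'.
rewrite /s_coef lk !ffunE ?ska ?tpermL ?tpermR ?ska ?tpermL ?tpermR.
by case E1: (eps (lo k)); case E2: (eps (hi k)); case E3: (eps (hi k')) => //= _;
  rewrite ?mulr1 ?mul1r ?H1 ?H2 ?H3 ?E1 ?E2 ?E3.
Qed.

(** If the three signs agree this is the braid relation of the KLR algebra, read
backwards when the strands are inverted; otherwise both sides vanish. *)
Lemma mE_braid i :
    (mS k' * mS k * mS k' - mS k * mS k' * mS k) * mE i =
    braid_val p (tnth i (lo k)) (tnth i (hi k)) (tnth i (hi k'))
      (mX (lo k)) (mX (hi k)) (mX (hi k')) * mE i.
Proof.
pose c1 eps := s_coef (swap_sgn k (swap_sgn k' eps)) k' * s_coef (swap_sgn k' eps) k * s_coef eps k'.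
pose c2 eps := s_coef (swap_sgn k' (swap_sgn k eps)) k * s_coef (swap_sgn k eps) k' * s_coef eps k.
have S1 : mS k' * mS k * mS k' = mono (fun eps => swap_sgn k' (swap_sgn k (swap_sgn k' eps))) c1.
  by rewrite !monoM.
have S2 : mS k * mS k' * mS k = mono (fun eps => swap_sgn k' (swap_sgn k (swap_sgn k' eps))) c2.
  by rewrite !monoM; apply: mono_eq => // eps _; rewrite swap_sgn_braid.
rewrite S1 S2 mono_braid monoN monoD !monoM.
apply: mono_eq => eps.
  have [/andP[/eqP E1 /eqP E2]|mixed] :=
    boolP ((eps (lo k) == eps (hi k)) && (eps (hi k) == eps (hi k'))).
    have E3 : eps (lo k') = eps (hi k') by rewrite (lo_succ kk').
    rewrite /c1 /c2 !(swap_sgn_id E1, swap_sgn_id E3) !s_coef_same //.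
    rewrite -[tnth i (lo k)](twistK (eps (lo k))) -[tnth i (hi k)](twistK (eps (hi k))).
    rewrite -[tnth i (hi k')](twistK (eps (hi k'))) -!tnth_straight /x_coef -E2 -E1.
    rewrite braid_val_twist //; have := crossing_succ kk' E1 E2.
    have := crossing_lohi E1; have := crossing_lohi E3; rewrite (lo_succ kk') -E1.
    case: ifP => _ [H1 H2] [H3 H4] Hs.
      by rewrite -opprB !mulNr (law_braid L) // -H1 -H2 -H4.
    by rewrite (law_braid L) // -H3 -H4 -H2.
  rewrite /c1 /c2 s_coef_braid // subrr mul0r.
  have [->|ki] := E_cases eps i; first by rewrite mulr0.
  by rewrite (braid_val_mixed hp0 Idisj ki) // mul0r.
move=> H; have [/andP[/eqP E1 /eqP E2]|mixed] :=
    boolP ((eps (lo k) == eps (hi k)) && (eps (hi k) == eps (hi k'))).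
  have E3 : eps (lo k') = eps (hi k') by rewrite (lo_succ kk').
  by rewrite !(swap_sgn_id E3, swap_sgn_id E1).
by case: H; rewrite /c1 /c2 s_coef_braid // subrr mul0r.
Qed.
End Adjacent.

Lemma mE_sx k l i :
  (mS k * mX l - mX (tperm (lo k) (hi k) l) * mS k) * mE i =
  sx_val MS (tnth i (lo k)) (tnth i (hi k)) (l == lo k) (l == hi k) * mE i.
Proof.
rewrite mono_sx !monoM monoN monoD monoM.
have main eps : (s_coef eps k * x_coef eps l -
      x_coef (swap_sgn k eps) (tperm (lo k) (hi k) l) * s_coef eps k) *
      E (straight eps i) =
    sx_val B (tnth i (lo k)) (tnth i (hi k)) (l == lo k) (l == hi k) *
      E (straight eps i).
  have [same|mixed] := eqVneq (eps (lo k)) (eps (hi k)); last first.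
    rewrite x_coef_swap // s_coef_mixed // mul1r mulr1 subrr mul0r.
    have [->|ki] := E_cases eps i; first by rewrite mulr0.
    by rewrite (sx_val_mixed hp0 Idisj ki) // mul0r.
  rewrite s_coef_same // swap_sgn_id // /x_coef -sw_crossing //.
  have -> : eps (tperm (lo k) (hi k) l) = eps l.
    by rewrite -[in RHS](swap_sgn_id same) ffunE.
  rewrite signed_mull signed_mulr signed_opp signedD signed_mull (law_sx L) // -signed_mull.
  congr (_ * _).
  rewrite -[tnth i (lo k)](twistK (eps (lo k))) -[tnth i (hi k)](twistK (eps (hi k))).
  rewrite -!tnth_straight -same sx_val_twist; last first.
    by case: eqP => // ->; rewrite (negbTE (lo_neq_hi k)).
  have := crossing_lohi same.
  have pI := inj_eq (@perm_inj _ (pos eps)).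
  have [ll|l1] := eqVneq l (lo k); [|have [ll|l2] := eqVneq l (hi k)].
  - by rewrite ll; case: ifP => es [-> ->]; rewrite !pI eqxx (negbTE (lo_neq_hi k)) ?es.
  - by rewrite ll -same; case: ifP => es [-> ->];
      rewrite !pI eqxx eq_sym (negbTE (lo_neq_hi k)) ?es.
  - by case: ifP => es [-> ->]; rewrite !pI (negbTE l1) (negbTE l2) /sx_val !andbF;
      case: (eps l); rewrite /= ?oppr0.
apply: mono_eq => [eps|eps H]; first exact: main.
have [same|mixed] := eqVneq (eps (lo k)) (eps (hi k)); first by rewrite swap_sgn_id.
by case: H; rewrite x_coef_swap // s_coef_mixed // mul1r mulr1 subrr mul0r.
Qed.

(** On each side exactly one of the two crossings survives straightening, and it is
the crossing of the same two strands. *)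
Lemma mPi_spi k : k = 0%N :> nat -> mS k * mPi * (mS k * mPi) = mPi * mS k * (mPi * mS k).
Proof.
move=> k0; rewrite !monoM; apply: mono_eq => [eps|eps _]; last exact: swap_flip_braid.
rewrite !mul1r !mulr1.
have lo0 : lo k = ord0 by apply: ord_inj; rewrite val_lo k0.
have hi0 : hi k == ord0 = false by rewrite -lo0 eq_sym; apply/negbTE/lo_neq_hi.
have fl d : flip_sgn d (lo k) = ~~ d (lo k) by rewrite ffunE lo0 eqxx.
have fh d : flip_sgn d (hi k) = d (hi k) by rewrite ffunE hi0.
rewrite /s_coef !(fl, fh, swap_sgn_lo, swap_sgn_hi) !crossing_flip.
case E1: (eps (lo k)); case E2: (eps (hi k)); rewrite /= ?mulr1 ?mul1r //; congr (S _);
  rewrite crossing_swap_self ?fl ?fh ?E1 ?E2 ?crossing_flip //.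
Qed.

Hypothesis Esum : \sum_(j : klr_idx n.+1 tnu) E (val j) = 1.

(** Straightening is a bijection from the sequences of sign vector [eps] to the
sequences of the KLR algebra. *)
Lemma sum_straight eps : \sum_(i : theta_idx n.+1 nu) E (straight eps (val i)) = 1.
Proof.
have inner (i : theta_idx n.+1 nu) : E (straight eps (val i)) =
    \sum_(j : klr_idx n.+1 tnu | val j == straight eps (val i)) E (val j).
  have [ki|ki] := boolP (klr_seq tnu (straight eps (val i))).
    pose j0 : klr_idx n.+1 tnu := Sub _ ki.
    have j0E : val j0 = straight eps (val i) by exact: SubK.
    by rewrite -j0E (eq_bigl (pred1 j0)) ?big_pred1_eq // => j;
       apply/eqP/eqP => [/val_inj|->].
  rewrite (Eout ki) big1 // => j /eqP ji; by rewrite -ji (valP j) in ki.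
under eq_bigr do rewrite inner.
rewrite (exchange_big_dep xpredT) //= -Esum; apply: eq_bigr => j _.
have tj : theta_seq nu (unstraight eps (val j)).
  rewrite -(theta_straight nu eps) unstraightK; apply: (klr_theta Idisj hnu); exact: valP.
pose i0 : theta_idx n.+1 nu := Sub _ tj.
have i0E : val i0 = unstraight eps (val j) by exact: SubK.
rewrite (eq_bigl (pred1 i0)) ?big_pred1_eq // => i /=.
apply/eqP/eqP => [ji|->]; last by rewrite i0E unstraightK.
by apply: val_inj; rewrite i0E; exact/esym/(etrans (congr1 _ ji) (straightK eps _)).
Qed.

Lemma mE_sum : \sum_(i : theta_idx n.+1 nu) mE (val i) = 1.
Proof.
by rewrite mono_sum -(mono1 B (sgn n)); apply: mono_eq => // eps; exact: sum_straight.
Qed.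

Lemma matrix_vv_laws : vv_laws p mX mS mE mPi.
Proof.
split.
- split.
  + exact: mE_ee.
  + exact: mE_se.
  + exact: mE_xe.
  + exact: mX_comm.
  + exact: mE_quad.
  + exact: mS_far.
  + by move=> k k' i kk'; exact: mE_braid.
  + exact: mE_sx.
- move=> i; rewrite !monoM; apply: mono_eq => // eps.
  by rewrite mul1r mulr1 straight_flip.
- rewrite monoM -(mono1 B (sgn n)); apply: mono_eq => [eps|eps _]; first by rewrite mul1r.
  exact: flip_sgnK.
- rewrite !monoM monoN; apply: mono_eq => // eps.
  by rewrite x_coef_flip eqxx mul1r mulr1 opprK.
- move=> l l0; rewrite !monoM; apply: mono_eq => // eps.
  by rewrite x_coef_flip (negbTE l0) mul1r mulr1.
- exact: mPi_spi.
- move=> k k0; rewrite !monoM; apply: mono_eq => [eps|eps _].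
    by rewrite s_coef_flip // mul1r mulr1.
  by rewrite swap_flip_sgn.
Qed.

End MatrixModel.

(** * Transporting the corner to every sign vector *)

Section Transport.
Variables (F : fieldType) (p lam : F) (n : nat) (nu : {mset F}%mset).
Hypothesis hp0 : p != 0.
Hypothesis Idisj : (Iplus p lam `&` Iminus p lam = set0)%classic.
Hypothesis hnu : thetaN (Iorbit p lam) nu.
Local Notation tnu := (mset_restrict (Iplus p lam) nu).
Variables (A : kalg F) (X : 'I_n.+1 -> A) (S : 'I_n -> A) (E : n.+1.-tuple F -> A) (Pi : A).
Hypothesis LV : vv_laws p X S E Pi.
Hypothesis Eout : forall i, ~~ theta_seq nu i -> E i = 0.
Hypothesis Esum : \sum_(i : theta_idx n.+1 nu) E (val i) = 1.
Implicit Types (k : 'I_n) (l r : 'I_n.+1) (eps : sgn n) (i : n.+1.-tuple F).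

Let L : klr_laws p X S E := law_klr LV.

(** The idempotents add up to the identity. *)
Lemma eq_on_idem a b : (forall i, a * E i = b * E i) -> a = b.
Proof.
by move=> ab; rewrite -[a]mulr1 -[b]mulr1 -Esum !mulr_sumr; apply: eq_bigr.
Qed.

Definition sign_idem eps : A :=
  \sum_(i : theta_idx n.+1 nu | klr_seq tnu (straight eps (val i))) E (val i).

Lemma sign_idem_mulE eps i : sign_idem eps * E i = if klr_seq tnu (straight eps i) then E i else 0.
Proof.
have [ti|ti] := boolP (theta_seq nu i); last by rewrite (Eout ti) mulr0 if_same.
pose i0 : theta_idx n.+1 nu := Sub i ti.
have i0E : val i0 = i by exact: SubK.
rewrite /sign_idem mulr_suml big_mkcond (bigD1 i0) //= big1 ?addr0.
  by rewrite (law_ee L) eqxx.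
move=> j ji; case: ifP => // _; rewrite (law_ee L) ifF //.
by apply/eqP => jE; move/eqP: ji; apply; apply: val_inj; rewrite i0E.
Qed.

Lemma idem_comm_sign_idem eps i : E i * sign_idem eps = sign_idem eps * E i.
Proof.
rewrite /sign_idem mulr_suml mulr_sumr; apply: eq_bigr => j _.
by rewrite !(law_ee L) eq_sym; case: eqP => // ->.
Qed.

Lemma sign_idem_idem eps : sign_idem eps * sign_idem eps = sign_idem eps.
Proof.
apply: eq_on_idem => i; rewrite -mulrA sign_idem_mulE.
by case: ifP => ki; rewrite ?mulr0 // sign_idem_mulE ki.
Qed.

Lemma sign_idem_orth eps eps' : eps != eps' -> sign_idem eps * sign_idem eps' = 0.
Proof.
move=> ne; apply: eq_on_idem => i; rewrite -mulrA sign_idem_mulE mul0r.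
case: ifP => ki; rewrite ?mulr0 // sign_idem_mulE ifF //; apply/negP => ki'.
by rewrite (straight_unique Idisj hnu ki' ki) eqxx in ne.
Qed.

Lemma sign_idem_sum : \sum_eps sign_idem eps = 1.
Proof.
apply: eq_on_idem => i; rewrite mul1r mulr_suml.
under eq_bigr do rewrite sign_idem_mulE.
have [ti|ti] := boolP (theta_seq nu i); last first.
  by rewrite (Eout ti) big1 // => eps _; rewrite if_same.
have [eps0 k0] := straight_exists Idisj hnu ti.
rewrite (bigD1 eps0) //= k0 big1 ?addr0 // => eps ne; rewrite ifF //.
by apply/negP => ke; rewrite (straight_unique Idisj hnu ke k0) eqxx in ne.
Qed.

Lemma klr_straight_swap eps k i :
  klr_seq tnu (straight (swap_sgn k eps) (swap_seq k i)) = klr_seq tnu (straight eps i).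
Proof.
have [same|mixed] := eqVneq (eps (lo k)) (eps (hi k)).
  by rewrite swap_sgn_id // straight_swap_same // klr_swap.
by rewrite straight_swap_mixed.
Qed.

Lemma crossing_sign_idem eps k : S k * sign_idem eps = sign_idem (swap_sgn k eps) * S k.
Proof.
apply: eq_on_idem => i; rewrite -!mulrA sign_idem_mulE (law_se L) mulrA sign_idem_mulE.
by rewrite klr_straight_swap; case: ifP => _; rewrite ?mulr0 ?mul0r // (law_se L).
Qed.

Lemma flip_sign_idem eps : Pi * sign_idem eps = sign_idem (flip_sgn eps) * Pi.
Proof.
apply: eq_on_idem => i; rewrite -!mulrA sign_idem_mulE (law_pie LV) mulrA sign_idem_mulE.
by rewrite straight_flip; case: ifP => _; rewrite ?mulr0 ?mul0r // (law_pie LV).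
Qed.

Lemma x_sign_idem eps l : X l * sign_idem eps = sign_idem eps * X l.
Proof. by rewrite /sign_idem mulr_suml mulr_sumr; apply: eq_bigr => j _; rewrite (law_xe L). Qed.

Definition plus_idem : A := sign_idem (plus_sgn n).

Lemma plus_idem_mulE i : plus_idem * E i = if klr_seq tnu i then E i else 0.
Proof. by rewrite sign_idem_mulE straight_plus. Qed.

Definition crossing_nat (j : nat) : A := oapp S 1 (insub j).
(** The word [s_(j-1) ... s_0 * pi], which flips the first strand and then
carries it to position [j]. *)
Fixpoint flip_at (j : nat) : A := if j is j'.+1 then crossing_nat j' * flip_at j' else Pi.

Lemma crossing_nat_ord k : crossing_nat k = S k.
Proof. by rewrite /crossing_nat valK. Qed.

Lemma flip_at_comm k j : (j < k)%N -> GRing.comm (S k) (flip_at j).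
Proof.
elim: j => [|j IH] jk /=; first by rewrite /GRing.comm (law_pis LV) // -lt0n.
apply: commrM; last by apply: IH; exact: ltnW.
have jn : (j < n)%N by apply: ltn_trans (ltn_ord k); exact: ltnW.
by rewrite -[j]/(val (Ordinal jn)) crossing_nat_ord; apply: (law_ss L); rewrite jk orbT.
Qed.

Definition nat_sgn eps (j : nat) : bool := eps (inord j).
(** The product of the words [flip_at j] over the inverted positions [j], in
increasing order. It is locked lest rewriting with associativity should open
the product. *)
Definition transport eps : A :=
  locked ((\prod_(0 <= j < n.+1) (if nat_sgn eps j then flip_at j else 1)) * plus_idem).

Lemma nat_sgn_ord eps l : nat_sgn eps l = eps l.
Proof. by rewrite /nat_sgn inord_val. Qed.

Lemma transport_plus_idem eps : transport eps * plus_idem = transport eps.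
Proof. by rewrite /transport -lock -mulrA sign_idem_idem. Qed.

Lemma transport_plus : transport (plus_sgn n) = plus_idem.
Proof. by rewrite /transport -lock big1 ?mul1r // => j _; rewrite /nat_sgn ffunE. Qed.

(** The word of position [k.+1] is [S k] times that of position [k], and [S k]
commutes with the words of the earlier positions. *)
Lemma transport_swap eps k : eps (lo k) = false -> eps (hi k) = true ->
  transport eps = S k * transport (swap_sgn k eps).
Proof.
move=> elo ehi; rewrite /transport -!lock mulrA; congr (_ * plus_idem).
have kn := ltn_ord k; have same j : (j < n.+1)%N -> j != k -> j != k.+1 ->
    nat_sgn (swap_sgn k eps) j = nat_sgn eps j.
  move=> jn jk jk1; rewrite -[j]/(val (Ordinal jn)) !nat_sgn_ord ffunE tpermD //.
    by rewrite -val_eqE eq_sym.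
  by rewrite -(inj_eq val_inj) [val (hi k)]val_hi eq_sym.
have split_prod (f : nat -> A) : \prod_(0 <= j < n.+1) f j =
    \prod_(0 <= j < k) f j * (f k * (f k.+1 * \prod_(k.+2 <= j < n.+1) f j)).
  rewrite (big_cat_nat (n := k)) //=; last by lia.
  by congr (_ * _); rewrite big_ltn; [rewrite big_ltn|]; rewrite ?ltnS //; lia.
have vlo d : nat_sgn d k = d (lo k) by rewrite -nat_sgn_ord.
have vhi d : nat_sgn d k.+1 = d (hi k) by rewrite -nat_sgn_ord val_hi.
rewrite !split_prod !vlo !vhi swap_sgn_lo swap_sgn_hi elo ehi !mul1r.
rewrite [flip_at k.+1]/= crossing_nat_ord.
set P1 := \prod_(0 <= j < k) (if nat_sgn eps j then flip_at j else 1).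
set P3 := \prod_(k.+2 <= j < n.+1) (if nat_sgn eps j then flip_at j else 1).
have -> : \prod_(0 <= j < k) (if nat_sgn (swap_sgn k eps) j then flip_at j else 1) = P1.
  by apply: eq_big_nat => j /andP[_ jk]; rewrite same //; lia.
have -> : \prod_(k.+2 <= j < n.+1) (if nat_sgn (swap_sgn k eps) j then flip_at j else 1) = P3.
  by apply: eq_big_nat => j /andP[jk jn]; rewrite same //; lia.
have C : GRing.comm (S k) P1.
  rewrite /P1 big_nat; apply: commr_prod => j /andP[_ jk].
  by case: ifP => _; [exact: flip_at_comm | exact: commr1].
by rewrite -[S k * flip_at k * _]mulrA [RHS]mulrA C -mulrA.
Qed.

(** The word of position [0] is the reflection, and comes first. *)
Lemma transport_flip eps : eps ord0 = true -> transport eps = Pi * transport (flip_sgn eps).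
Proof.
move=> e00; rewrite /transport -!lock mulrA; congr (_ * plus_idem).
rewrite [LHS]big_ltn // [X in Pi * X]big_ltn //.
have v0 d : nat_sgn d 0 = d ord0 by rewrite -nat_sgn_ord.
rewrite !v0 ffunE eqxx e00 mul1r; congr (_ * _); apply: eq_big_nat => j /andP[j0 jn].
rewrite -[j]/(val (Ordinal jn)) !nat_sgn_ord ffunE.
have -> // : (Ordinal jn == ord0) = false.
by apply/negbTE; rewrite -val_eqE /= -lt0n.
Qed.

Lemma idem_transport eps i : E i * transport eps = transport eps * E (straight eps i).
Proof.
elim/sgn_ind: eps i => [|eps e00 IH|eps k elo ehi IH] i.
- by rewrite transport_plus straight_plus idem_comm_sign_idem.
- rewrite transport_flip ?flip_sgnK; last by rewrite ffunE eqxx e00.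
  by rewrite mulrA -[i]inv_firstK -(law_pie LV) -!mulrA IH straight_flip.
- rewrite (@transport_swap (swap_sgn k eps) k) ?swap_sgnK ?swap_sgn_lo ?swap_sgn_hi //.
  rewrite mulrA -[i](swap_seqK k) -(law_se L) -!mulrA IH.
  by rewrite straight_swap_mixed // elo ehi.
Qed.

Lemma idem_transport_out eps i : ~~ klr_seq tnu (straight eps i) -> E i * transport eps = 0.
Proof.
by move=> ki; rewrite idem_transport -transport_plus_idem -mulrA plus_idem_mulE (negbTE ki) mulr0.
Qed.

(** Identities may be checked on the idempotents whose sequences have the signs
of the transported summand. *)
Lemma eq_on_transport a b eps :
    (forall i, klr_seq tnu (straight eps i) -> a * E i = b * E i) ->
  a * transport eps = b * transport eps.
Proof.
move=> ab; rewrite -[a]mulr1 -[b]mulr1 -Esum -!mulrA !mulr_suml !mulr_sumr.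
apply: eq_bigr => i _; have [ki|ki] := boolP (klr_seq tnu (straight eps (val i))).
  by rewrite !mulrA ab.
by rewrite idem_transport_out // !mulr0.
Qed.

Lemma eq_on_sign_idem a b eps :
    (forall i, klr_seq tnu (straight eps i) -> a * E i = b * E i) ->
  a * sign_idem eps = b * sign_idem eps.
Proof. by move=> ab; rewrite /sign_idem !mulr_sumr; apply: eq_bigr => i; exact: ab. Qed.

Lemma crossing_mixed_sqr eps k i : eps (lo k) != eps (hi k) ->
  klr_seq tnu (straight eps i) -> S k * S k * E i = 1 * E i.
Proof.
by move=> mixed ki; rewrite (law_quad L) (quad_val_mixed hp0 Idisj ki).
Qed.

Lemma crossing_transport_mixed eps k : eps (lo k) != eps (hi k) -> S k * transport eps = transport (swap_sgn k eps).
Proof.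
move=> mixed; case elo: (eps (lo k)) mixed; case ehi: (eps (hi k)) => // _.
  by rewrite (@transport_swap (swap_sgn k eps) k) ?swap_sgnK ?swap_sgn_lo ?swap_sgn_hi.
rewrite (transport_swap elo ehi) mulrA -[RHS]mul1r; apply: eq_on_transport => i.
by apply: crossing_mixed_sqr; rewrite swap_sgn_lo swap_sgn_hi elo ehi.
Qed.

Lemma flip_transport eps : Pi * transport eps = transport (flip_sgn eps).
Proof.
case e00: (eps ord0); last by rewrite (@transport_flip (flip_sgn eps)) ?flip_sgnK // ffunE eqxx e00.
by rewrite (transport_flip e00) mulrA (law_pipi LV) mul1r.
Qed.

Lemma x_transport eps l : X l * transport eps = transport eps * x_coef X eps l.
Proof.
elim/sgn_ind: eps l => [|eps e00 IH|eps k elo ehi IH] l.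
- by rewrite transport_plus x_sign_idem /x_coef ffunE pos_plus.
- rewrite -flip_transport mulrA x_coef_flip; case: eqVneq => [->|l0].
    by rewrite -[X ord0 * Pi]opprK -(law_pix0 LV) mulNr -!mulrA IH !mulrN.
  by rewrite -(law_pix LV) // -!mulrA IH.
- have mixed : eps (lo k) != eps (hi k) by rewrite elo ehi.
  rewrite -crossing_transport_mixed // mulrA.
  have -> : X l * S k * transport eps = S k * X (tperm (lo k) (hi k) l) * transport eps.
    apply: eq_on_transport => i ki; have := law_sx L k (tperm (lo k) (hi k) l) i.
    rewrite tpermK (sx_val_mixed hp0 Idisj ki) // mul0r mulrBl => /eqP.
    by rewrite subr_eq0 => /eqP.
  by rewrite -!mulrA IH -(x_coef_swap _ _ mixed) tpermK.
Qed.

Lemma braid_transport_mixed eps (k k' : 'I_n) : k' = k.+1 :> nat ->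
    ~~ ((eps (lo k) == eps (hi k)) && (eps (hi k) == eps (hi k'))) ->
  S k' * (S k * (S k' * transport eps)) = S k * (S k' * (S k * transport eps)).
Proof.
move=> kk' mixed; rewrite !mulrA; apply: eq_on_transport => i ki.
have := law_braid L i kk'; rewrite (braid_val_mixed hp0 Idisj ki) // mul0r mulrBl.
by move/eqP; rewrite subr_eq0 => /eqP.
Qed.

(** By induction on the weight, splitting off the move which brings the first
inverted strand one step back. That move either is distant from the crossing or
combines with it and further moves into a braid relation; in type A this has no
correction term, as its three strands do not all have the same sign. *)
Lemma crossing_transport_same eps k : eps (lo k) = eps (hi k) ->
  S k * transport eps = transport eps * S (crossing eps k).
Proof.
have [m] := ubnP (weight eps); elim: m eps k => // m IH eps k wm same.
have [->|epsN] := eqVneq eps (plus_sgn n).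
  by rewrite transport_plus crossing_sign_idem swap_sgn_id ?crossing_plus // !ffunE.
have [l el ml] := first_minus epsN; have [l0|l0] := eqVneq l ord0.
  have e00 : eps ord0 = true by rewrite -l0.
  have wf := weight_flip e00; have uE := transport_flip e00.
  (* The first strand is inverted, so the reflection can be split off. *)
  have [k0|k0] := eqVneq (k : nat) 0%N; last first.
    rewrite uE mulrA -(law_pis LV) // -!mulrA IH ?crossing_flip //.
      exact: leq_trans wf wm.
    by rewrite !ffunE -!val_eqE /= (negbTE k0).
  (* The first two strands are inverted: flip, swap and flip are split off. *)
  have lo0 : lo k = ord0 by apply: ord_inj; rewrite val_lo k0.
  have fl d : flip_sgn d (lo k) = ~~ d (lo k) by rewrite ffunE lo0 eqxx.
  have fh d : flip_sgn d (hi k) = d (hi k).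
    by rewrite ffunE -lo0 eq_sym (negbTE (lo_neq_hi k)).
  have elo : eps (lo k) = true by rewrite lo0.
  have ehi : eps (hi k) = true by rewrite -same.
  set eps1 := flip_sgn eps in uE wf; set eps2 := swap_sgn k eps1.
  have ws : (weight eps2 < weight eps1)%N by apply: weight_swap; rewrite ?fl ?fh ?elo ?ehi.
  have u1E : transport eps1 = S k * transport eps2 by apply: transport_swap; rewrite ?fl ?fh ?elo ?ehi.
  have e20 : eps2 ord0 = true by rewrite -lo0 swap_sgn_lo fh.
  have wf2 := weight_flip e20.
  rewrite uE u1E (transport_flip e20); set eps3 := flip_sgn eps2 in wf2 *.
  have -> : S k * (Pi * (S k * (Pi * transport eps3))) = Pi * (S k * (Pi * (S k * transport eps3))).
    have := congr1 (fun a => a * transport eps3) (law_spi LV k0).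
    by rewrite !mulrA.
  rewrite IH; first last.
  - by rewrite fl fh swap_sgn_lo swap_sgn_hi fh fl elo ehi.
  - by rewrite -ltnS; apply: leq_trans wm; rewrite ltnS; apply: ltn_trans wf; apply: ltn_trans ws.
  rewrite crossing_flip crossing_swap_self ?fl ?fh ?elo ?ehi // crossing_flip.
  by rewrite !mulrA.
have [k' [hl elo ehi]] := first_minus_swap el ml l0.
have mixed : eps (lo k') != eps (hi k') by rewrite elo ehi.
have ws := leq_trans (weight_swap elo ehi) wm.
have uE : transport eps = S k' * transport (swap_sgn k' eps) by apply: transport_swap.
have [far|near] := boolP ((k.+1 < k')%N || (k'.+1 < k)%N).
  rewrite uE mulrA (law_ss L) // -!mulrA IH ?mulrA //; last first.
    by rewrite !swap_sgn_lo_far // orbC.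
  by rewrite crossing_far // orbC.
set eps1 := swap_sgn k' eps in uE ws; rewrite uE.
have [kk'|[kk'|kk']] : k' = k.+1 :> nat \/ (k = k'.+1 :> nat \/ k = k').
  case: (ltngtP k k') => [lt|gt|/ord_inj ->]; last by right; right.
    by left; move: near; lia.
  by right; left; move: near; lia.
- have lk := lo_succ kk'; have sadj := sw_adj kk'.
  (* The signs at k, k + 1, k + 2 are plus, plus, minus. *)
  have e1 : eps1 (lo k) = false by rewrite ffunE sadj same -lk.
  have e1' : eps1 (hi k) = true by rewrite ffunE sadj.
  have wt := weight_swap e1 e1'.
  rewrite (transport_swap e1 e1'); set eps2 := swap_sgn k eps1 in wt *.
  have e2 : eps2 (hi k) = false by rewrite swap_sgn_hi.
  have e2' : eps2 (hi k') = false by rewrite !ffunE !sadj -lk.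
  have e2'' : eps2 (lo k) = true by rewrite swap_sgn_lo.
  rewrite -braid_transport_mixed //; last by rewrite e2 e2''.
  rewrite IH ?lk ?e2 ?e2' //; last by apply: leq_trans ws; exact: ltnW.
  have [-> //] := crossing_adj kk' eps; first by rewrite !mulrA.
  by rewrite -lk elo ehi.
- have lk := lo_succ kk'; have sadj := sw_adj kk'.
  (* The signs at k - 1, k, k + 1 are plus, minus, minus. *)
  have e1 : eps1 (lo k) = false by rewrite lk swap_sgn_hi.
  have e1' : eps1 (hi k) = true by rewrite ffunE sadj -same lk.
  have wt := weight_swap e1 e1'.
  rewrite (transport_swap e1 e1'); set eps2 := swap_sgn k eps1 in wt *.
  have e2 : eps2 (hi k') = true by rewrite -lk swap_sgn_lo.
  have e2' : eps2 (hi k) = false by rewrite swap_sgn_hi.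
  have e2'' : eps2 (lo k') = true by rewrite ffunE sadj swap_sgn_lo.
  rewrite braid_transport_mixed //; last by rewrite e2 e2' andbF.
  rewrite IH ?e2 ?e2'' //; last by apply: leq_trans ws; exact: ltnW.
  have [_ -> //] := crossing_adj kk' eps; first by rewrite !mulrA.
  by rewrite -lk.
- by rewrite -kk' same eqxx in mixed.
Qed.

(** Every elementary move is invertible on the summand where it is applied. *)
Lemma transport_inverse eps :
  exists v, [/\ v * transport eps = plus_idem, transport eps * v = sign_idem eps & plus_idem * v = v].
Proof.
elim/sgn_ind: eps => [|eps e00 [v [vu uv ev]]|eps k elo ehi [v [vu uv ev]]].
- by exists plus_idem; rewrite transport_plus sign_idem_idem.
- exists (v * Pi); rewrite -flip_transport; split; last by rewrite mulrA ev.
    by rewrite mulrA -[v * Pi * Pi]mulrA (law_pipi LV) mulr1.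
  rewrite mulrA -[Pi * transport eps * v]mulrA uv flip_sign_idem -mulrA (law_pipi LV) mulr1 //.
- have mixed : eps (lo k) != eps (hi k) by rewrite elo ehi.
  have mixed' : swap_sgn k eps (lo k) != swap_sgn k eps (hi k).
    by rewrite swap_sgn_lo swap_sgn_hi eq_sym.
  exists (v * S k); rewrite -crossing_transport_mixed //; split; last by rewrite mulrA ev.
    rewrite mulrA -[v * S k * S k]mulrA -mulrA.
    by rewrite (eq_on_transport (fun i => crossing_mixed_sqr mixed)) mul1r.
  rewrite mulrA -[S k * transport eps * v]mulrA uv crossing_sign_idem.
  have comm : S k * S k * sign_idem (swap_sgn k eps) = sign_idem (swap_sgn k eps) * S k * S k.
    by rewrite -mulrA crossing_sign_idem swap_sgnK mulrA crossing_sign_idem.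
  by rewrite -comm (eq_on_sign_idem (fun i => crossing_mixed_sqr mixed')) mul1r.
Qed.

End Transport.

(** * The KLR algebra as a corner of the VV algebra *)

Section CornerLaws.
Variables (F : fieldType) (A : kalg F) (e : A) (ee : e * e = e).
Local Notation C := (corner_alg ee).

Lemma cut_mem a : e * a * e \in corner_pred ee.
Proof. by apply/cornerP; rewrite !mulrA ee -!mulrA ee. Qed.

Definition cut (a : A) : C := Corner (cut_mem a).

Lemma cutD a b : cut (a + b) = cut a + cut b.
Proof. by apply: val_inj; rewrite /= mulrDr mulrDl. Qed.
Lemma cutN a : cut (- a) = - cut a.
Proof. by apply: val_inj; rewrite /= mulrN mulNr. Qed.
Lemma cut0 : cut 0 = 0.
Proof. by apply: val_inj; rewrite /= mulr0 mul0r. Qed.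
Lemma cut1 : cut 1 = 1.
Proof. by apply: val_inj; rewrite /= mulr1 ee. Qed.
Lemma cut_sum (I : finType) (f : I -> A) : cut (\sum_i f i) = \sum_i cut (f i).
Proof. exact: (big_morph cut cutD cut0). Qed.
(** Cutting down to a corner is multiplicative on the elements which commute with
the idempotent. *)
Lemma cutM a b : GRing.comm e b -> cut (a * b) = cut a * cut b.
Proof.
move=> eb; apply: val_inj; rewrite /= -!mulrA; congr (_ * (_ * _)).
by rewrite [e * (e * _)]mulrA ee mulrA eb -mulrA ee.
Qed.

Variables (p : F) (n : nat) (X : 'I_n.+1 -> A) (S : 'I_n -> A) (E : n.+1.-tuple F -> A).
Hypotheses (eX : forall l, GRing.comm e (X l)) (eS : forall k, GRing.comm e (S k)).
Hypothesis eE : forall i, GRing.comm e (E i).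
Hypothesis L : klr_laws p X S E.

Lemma cut_quad a b x y : GRing.comm e x -> GRing.comm e y ->
  quad_val p a b (cut x) (cut y) = cut (quad_val p a b x y).
Proof.
move=> ex ey; rewrite /quad_val; do !case: ifP => _; rewrite -?cutN -?cutD ?cut0 ?cut1 //.
by rewrite cutM //; apply: commrB.
Qed.

Lemma cut_braid a b c x y z :
  braid_val p a b c (cut x) (cut y) (cut z) = cut (braid_val p a b c x y z).
Proof.
rewrite /braid_val; do !case: ifP => _;
by rewrite ?mulr2n -?cutN -?cutD ?cut0 ?cutN ?cut1.
Qed.

Lemma cut_sx (a b : F) isl ish : sx_val C a b isl ish = cut (sx_val A a b isl ish).
Proof. by rewrite /sx_val; do !case: ifP => _; rewrite ?cutN ?cut0 ?cut1. Qed.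

Lemma corner_klr_laws :
  klr_laws p (fun l => cut (X l)) (fun k => cut (S k)) (fun i => cut (E i)).
Proof.
have cM := (commrM, eX, eS, eE).
split.
- by move=> i j; rewrite -cutM // (law_ee L); case: eqP => // _; rewrite cut0.
- by move=> k i; rewrite -!cutM // (law_se L).
- by move=> l i; rewrite -!cutM // (law_xe L).
- by move=> l l'; rewrite -!cutM // (law_xx L).
- by move=> k i; rewrite cut_quad // -!cutM // (law_quad L).
- by move=> j k far; rewrite -!cutM // (law_ss L).
- move=> k k' i kk'; rewrite cut_braid -!cutM //.
  by rewrite -cutN -cutD -cutM // (law_braid L).
- move=> k l i; rewrite cut_sx -!cutM //.
  by rewrite -cutN -cutD -cutM // (law_sx L).
Qed.

End CornerLaws.

Lemma mx_entryM (F : fieldType) (B : kalg F) (S : finType) (M N : mx_alg B #|S|) s t :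
  (M * N) (enum_rank s) (enum_rank t) =
  \sum_r M (enum_rank s) (enum_rank r) * N (enum_rank r) (enum_rank t).
Proof.
rewrite -[LHS]/((M *m N) _ _) mxE (reindex enum_rank) //=.
by exists enum_val => ? _; rewrite ?enum_rankK ?enum_valK.
Qed.

Lemma morita_refl (F : fieldType) (A : kalg F) : morita_equivalent A A.
Proof.
have vu (s t : unit) : 1 * 1 = if s == t then 1 else 0 :> A.
  by case: s; case: t; rewrite mul1r.
have uv : \sum_(s : unit) 1 * 1 = 1 :> A by rewrite (big_pred1 tt) ?mul1r // => -[].
have psiP (s : unit) (a : A) (t : unit) : a = 1 * a * 1 by rewrite mul1r mulr1.
pose fr : frame A A unit := @Frame F A A unit (fun=> 1) (fun=> 1) id (fun _ a _ => a)
  (fun _ _ => erefl) (fun _ _ => erefl) (fun c => esym (mulr1 _)) (fun _ _ => id)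
  (fun _ => mulr1 _) (fun _ => mulr1 _) vu uv psiP.
exact: (@frame_morita F A A unit fr tt).
Qed.

(** The algebras are kept abstract: [Aind] and [Bind] say that they are generated
by the given elements, [Psi] is the morphism to the matrix model and [Phi] the
morphism into the corner. *)
Section Assembly.
Variables (F : fieldType) (p lam : F) (n : nat) (nu : {mset F}%mset).
Hypothesis hp0 : p != 0.
Hypothesis Idisj : (Iplus p lam `&` Iminus p lam = set0)%classic.
Hypothesis hnu : thetaN (Iorbit p lam) nu.
Local Notation tnu := (mset_restrict (Iplus p lam) nu).

Variables (A : kalg F) (X : 'I_n.+1 -> A) (S : 'I_n -> A) (E : n.+1.-tuple F -> A) (Pi : A).
Hypothesis LV : vv_laws p X S E Pi.
Hypothesis Eout : forall i, ~~ theta_seq nu i -> E i = 0.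
Hypothesis Esum : \sum_(i : theta_idx n.+1 nu) E (val i) = 1.
Hypothesis Aind : forall P : A -> Prop, (forall l, P (X l)) -> (forall k, P (S k)) ->
  (forall i : theta_idx n.+1 nu, P (E (val i))) -> P Pi -> (forall c, P (kscal A c)) ->
  (forall a b, P a -> P b -> P (a + b)) -> (forall a b, P a -> P b -> P (a * b)) ->
  forall a, P a.

Variables (B : kalg F) (XB : 'I_n.+1 -> B) (SB : 'I_n -> B) (EB : n.+1.-tuple F -> B).
Hypothesis EBout : forall i, ~~ klr_seq tnu i -> EB i = 0.
Hypothesis EBsum : \sum_(i : klr_idx n.+1 tnu) EB (val i) = 1.
Hypothesis Bind : forall P : B -> Prop, (forall l, P (XB l)) -> (forall k, P (SB k)) ->
  (forall i : klr_idx n.+1 tnu, P (EB (val i))) -> (forall c, P (kscal B c)) ->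
  (forall a b, P a -> P b -> P (a + b)) -> (forall a b, P a -> P b -> P (a * b)) ->
  forall a, P a.

Local Notation MB := (mx_alg B #|sgn n|).
Variable Psi : A -> MB.
Hypotheses (PsiD : forall a b, Psi (a + b) = Psi a + Psi b)
  (PsiM : forall a b, Psi (a * b) = Psi a * Psi b)
  (PsiC : forall c, Psi (kscal A c) = kscal MB c).
Hypotheses (PsiX : forall l, Psi (X l) = mX XB l) (PsiS : forall k, Psi (S k) = mS SB k)
  (PsiE : forall i : theta_idx n.+1 nu, Psi (E (val i)) = mE EB (val i))
  (PsiPi : Psi Pi = mPi n B).

Local Notation e := (plus_idem p lam nu E).
Local Notation u := (transport p lam nu S E Pi).
Local Notation eS := (sign_idem p lam nu E).

Lemma plus_idem_idem : e * e = e.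
Proof. exact: (sign_idem_idem lam LV Eout Esum). Qed.

Lemma plus_idem_x l : GRing.comm e (X l).
Proof. exact/esym/(x_sign_idem lam nu LV _ _). Qed.
Lemma plus_idem_s k : GRing.comm e (S k).
Proof. by rewrite /GRing.comm (crossing_sign_idem lam LV Eout Esum) swap_sgn_id // !ffunE. Qed.
Lemma plus_idem_e i : GRing.comm e (E i).
Proof. exact/esym/(idem_comm_sign_idem lam nu LV _ _). Qed.

(** A sequence without inverted entries is a sequence of the KLR algebra. *)
Lemma plus_idem_klr_sum : \sum_(j : klr_idx n.+1 tnu) E (val j) = e.
Proof.
apply: (eq_on_idem Esum) => i; rewrite (plus_idem_mulE lam LV Eout) mulr_suml.
case: ifPn => ki.
  pose j0 : klr_idx n.+1 tnu := Sub i ki.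
  have j0E : val j0 = i by exact: SubK.
  rewrite (bigD1 j0) //= big1 ?addr0; first by rewrite (law_ee (law_klr LV)) eqxx.
  move=> j jj; rewrite (law_ee (law_klr LV)) ifF //; apply/eqP => ji.
  by move/eqP: jj; apply; apply: val_inj; rewrite j0E.
apply: big1 => j _; rewrite (law_ee (law_klr LV)) ifF //; apply/eqP => ji.
by rewrite -ji (valP j) in ki.
Qed.

Lemma cut_klr_sum : \sum_(j : klr_idx n.+1 tnu) cut plus_idem_idem (E (val j)) = 1.
Proof. by rewrite -cut_sum plus_idem_klr_sum; apply: val_inj; rewrite /= !plus_idem_idem. Qed.

Lemma corner_laws : klr_laws p (fun l => cut plus_idem_idem (X l)) (fun k => cut plus_idem_idem (S k))
  (fun i => cut plus_idem_idem (E i)).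
Proof. exact: (corner_klr_laws plus_idem_idem plus_idem_x plus_idem_s plus_idem_e (law_klr LV)). Qed.

Local Notation C := (corner_alg plus_idem_idem).
Variable Phi : B -> C.
Hypotheses (PhiD : forall a b, Phi (a + b) = Phi a + Phi b)
  (PhiM : forall a b, Phi (a * b) = Phi a * Phi b) (Phi1 : Phi 1 = 1)
  (PhiC : forall c, Phi (kscal B c) = kscal C c).
Hypotheses (PhiX : forall l, Phi (XB l) = cut plus_idem_idem (X l))
  (PhiS : forall k, Phi (SB k) = cut plus_idem_idem (S k))
  (PhiE : forall i : klr_idx n.+1 tnu, Phi (EB (val i)) = cut plus_idem_idem (E (val i))).

Local Notation phi b := (corner_val (Phi b)).

Lemma phi1 : phi 1 = e.
Proof. by rewrite Phi1. Qed.

Lemma PhiN a : Phi (- a) = - Phi a.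
Proof.
have Phi0 : Phi 0 = 0 by apply: (@addrI _ (Phi 0)); rewrite -PhiD !addr0.
by apply/eqP; rewrite -subr_eq0 opprK -PhiD addNr Phi0.
Qed.

Lemma phi0 : phi 0 = 0.
Proof. by rewrite -[0](subrr 1) PhiD PhiN subrr. Qed.

Lemma phi_sum (I : finType) (f : I -> B) : phi (\sum_i f i) = \sum_i phi (f i).
Proof.
by apply: (big_morph (fun b => phi b) _ phi0) => a b; rewrite PhiD.
Qed.

Lemma phiEB i : phi (EB i) = e * E i * e.
Proof.
have [ki|ki] := boolP (klr_seq tnu i).
  by have := PhiE (Sub i ki : klr_idx n.+1 tnu); rewrite [val _]SubK => ->.
by rewrite (EBout ki) phi0 (plus_idem_mulE lam LV Eout) (negbTE ki) mul0r.
Qed.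

Lemma transport_cut eps a : GRing.comm e a -> u eps * (e * a * e) = u eps * a.
Proof.
move=> ea; rewrite !mulrA (transport_plus_idem lam LV Eout Esum) -mulrA -ea mulrA.
by rewrite (transport_plus_idem lam LV Eout Esum).
Qed.

(** Multiplication by the idempotent is absorbed by the transport element. *)
Lemma transport_phi_x eps l : u eps * phi (x_coef XB eps l) = u eps * x_coef X eps l.
Proof.
rewrite /x_coef; case: (eps l); rewrite /= ?PhiN PhiX /= ?mulrN transport_cut //; exact: plus_idem_x.
Qed.

Lemma transport_phi_s eps eps' k :
  u eps' * phi (s_coef SB eps k) = u eps' * s_coef S eps k.
Proof.
rewrite /s_coef; case: ifP => _; first by rewrite PhiS /= transport_cut //; exact: plus_idem_s.
by rewrite phi1 mulr1 (transport_plus_idem lam LV Eout Esum).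
Qed.

Lemma crossing_transport eps k : S k * u eps = u (swap_sgn k eps) * s_coef S eps k.
Proof.
rewrite /s_coef; case: eqVneq => [same|mixed].
  by rewrite swap_sgn_id // (crossing_transport_same hp0 Idisj LV Eout Esum same).
by rewrite mulr1 (crossing_transport_mixed hp0 Idisj LV Eout Esum mixed).
Qed.

(** The transported summands form a basis over the KLR algebra in which the
generators act by the monomial matrices of the matrix model. *)
Lemma mul_transport a t : a * u t = \sum_s u s * phi (Psi a (enum_rank s) (enum_rank t)).
Proof.
have single r f c a' : a' * u r = u (f r) * phi (c r) -> Psi a' = mono f c ->
    a' * u r = \sum_s u s * phi (Psi a' (enum_rank s) (enum_rank r)).
  move=> -> ->; rewrite (bigD1 (f r)) //= monoE eqxx big1 ?addr0 // => s sf.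
  by rewrite monoE (negbTE sf) phi0 mulr0.
elim/Aind: a t => [l|k|i||c|a b IHa IHb|a b IHa IHb] t.
- apply: single (PsiX l); by rewrite transport_phi_x (x_transport hp0 Idisj LV Eout Esum).
- apply: single (PsiS k); by rewrite transport_phi_s crossing_transport.
- apply: single (PsiE i).
  by rewrite phiEB (transport_cut _ (plus_idem_e _)) (idem_transport lam nu hp0 LV).
- apply: single PsiPi; by rewrite phi1 (transport_plus_idem lam LV Eout Esum) (flip_transport lam nu LV).
- apply: (single t id (fun=> kscal B c)); last by rewrite PsiC mono_scal.
  by rewrite PhiC /= (kscal_central c e) mulrA (transport_plus_idem lam LV Eout Esum) kscal_central.
- rewrite PsiD mulrDl IHa IHb -big_split; apply: eq_bigr => s _ /=.
  by rewrite mxE PhiD mulrDr.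
- rewrite PsiM -mulrA IHb mulr_sumr.
  under eq_bigr => r _ do rewrite mulrA IHa mulr_suml.
  rewrite exchange_big; apply: eq_bigr => s _ /=.
  rewrite mx_entryM phi_sum mulr_sumr; apply: eq_bigr => r _.
  by rewrite PhiM -mulrA.
Qed.

(** A sequence without inverted entries is straightened to a sequence of the KLR
algebra by no other sign vector. *)
Lemma Psi_e : Psi e = mono id (fun eps => if eps == plus_sgn n then 1 else 0).
Proof.
have Psi0 : Psi 0 = 0 by apply: (@addrI _ (Psi 0)); rewrite -PsiD !addr0.
rewrite /plus_idem /sign_idem (big_morph Psi PsiD Psi0).
under eq_bigr do rewrite PsiE.
have -> : \sum_(i : theta_idx n.+1 nu | klr_seq tnu (straight (plus_sgn n) (val i)))
      mE EB (val i) =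
    \sum_(i : theta_idx n.+1 nu) mono id (fun eps =>
      if klr_seq tnu (val i) then EB (straight eps (val i)) else 0) :> MB.
  rewrite big_mkcond; apply: eq_bigr => i _; rewrite straight_plus.
  by case: ifP => // _; rewrite mono0.
rewrite mono_sum; apply: mono_eq => // eps; case: eqVneq => [->|ne].
  rewrite -(sum_straight Idisj hnu EBout EBsum (plus_sgn n)); apply: eq_bigr => i _.
  by rewrite straight_plus; case: ifPn => // /EBout.
apply: big1 => i _; case: ifPn => // ki; apply: EBout; apply: contra ne => ke.
rewrite -(straight_plus (val i)) in ki.
by rewrite (straight_unique Idisj hnu ke ki).
Qed.

(** The composite of [phi] with the matrix model is the inclusion of the
algebra as a diagonal corner, hence [phi] is injective. *)
Lemma Psi_phi b : Psi (phi b) = mono id (fun eps => if eps == plus_sgn n then b else 0).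
Proof.
have Psi_cut c (f : sgn n -> sgn n) (d : sgn n -> B) : Psi c = mono f d ->
    f (plus_sgn n) = plus_sgn n ->
    Psi (e * c * e) = mono id (fun eps => if eps == plus_sgn n then d eps else 0).
  move=> Ec f0; rewrite !PsiM Psi_e Ec !monoM; apply: mono_eq => eps.
    by case: (eqVneq eps) => [->|_]; rewrite ?mulr0 // f0 eqxx mulr1 mul1r.
  by case: (eqVneq eps) => [->|_]; rewrite ?mulr0.
elim/Bind: b => [l|k|i|c|a b IHa IHb|a b IHa IHb].
- rewrite PhiX (Psi_cut _ _ _ (PsiX l)) //; apply: mono_eq => // eps.
  by case: eqP => // ->; rewrite /x_coef ffunE pos_plus.
- have sp : swap_sgn k (plus_sgn n) = plus_sgn n by rewrite swap_sgn_id // !ffunE.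
  rewrite PhiS (Psi_cut _ _ _ (PsiS k)) //; apply: mono_eq => // eps.
  by case: eqP => // ->; rewrite /s_coef !ffunE eqxx crossing_plus.
- have ti := klr_theta Idisj hnu (valP i).
  have := PsiE (Sub (val i) ti : theta_idx n.+1 nu); rewrite [val (Sub _ _)]SubK => Pe.
  rewrite PhiE (Psi_cut _ _ _ Pe) //; apply: mono_eq => // eps.
  by case: eqP => // ->; rewrite straight_plus.
- rewrite PhiC /= PsiM PsiC Psi_e mono_scal monoM; apply: mono_eq => // eps.
  by case: ifP; rewrite ?mulr0 ?mulr1.
- rewrite PhiD PsiD IHa IHb monoD; apply: mono_eq => // eps.
  by case: ifP; rewrite ?addr0.
- rewrite PhiM PsiM IHa IHb monoM; apply: mono_eq => // eps.
  by case: ifP; rewrite ?mulr0.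
Qed.

Lemma phi_inj : injective (fun b => phi b).
Proof.
move=> a b /(congr1 Psi); rewrite !Psi_phi => /matrixP.
by move/(_ (enum_rank (plus_sgn n)) (enum_rank (plus_sgn n))); rewrite !monoE !eqxx.
Qed.

(** The transport elements and their inverses form a frame. *)
Theorem assembly_morita : morita_equivalent A B.
Proof.
have [v vP] := choice (transport_inverse hp0 Idisj LV Eout Esum).
have vu s t : v s * u t = if s == t then phi 1 else 0.
  have [vs us es] := vP s; have [vt ut et] := vP t.
  rewrite phi1; case: eqVneq => [<-//|st].
  have -> : v s = v s * eS s by rewrite -us mulrA vs es.
  have -> : u t = eS t * u t by rewrite -ut -mulrA vt (transport_plus_idem lam LV Eout Esum).
  rewrite -mulrA [eS s * _]mulrA (sign_idem_orth Idisj hnu LV Eout Esum st).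
  by rewrite mul0r mulr0.
have uv : \sum_s u s * v s = 1.
  rewrite -(sign_idem_sum Idisj hnu LV Eout Esum); apply: eq_bigr => s _.
  by have [_ -> _] := vP s.
have uphi s : u s * phi 1 = u s by rewrite phi1 (transport_plus_idem lam LV Eout Esum).
have phiv s : phi 1 * v s = v s by rewrite phi1; have [_ _ ->] := vP s.
have psiP s a t : phi (Psi a (enum_rank s) (enum_rank t)) = v s * a * u t.
  rewrite -mulrA mul_transport mulr_sumr (bigD1 s) //= mulrA vu eqxx phi1 corner_mull.
  by rewrite big1 ?addr0 // => r rs; rewrite mulrA vu eq_sym (negbTE rs) mul0r.
have fD a b : phi (a + b) = phi a + phi b by rewrite PhiD.
have fM a b : phi (a * b) = phi a * phi b by rewrite PhiM.
have fC c : phi (kscal B c) = kscal A c * phi 1 by rewrite phi1 PhiC.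
pose fr := Frame fD fM fC phi_inj uphi phiv vu uv psiP.
have [vp up ep] := vP (plus_sgn n).
have u0 : u (plus_sgn n) = phi 1 by rewrite phi1 transport_plus.
apply: (@frame_morita F A B _ fr (plus_sgn n)) => //=.
by rewrite phi1; rewrite u0 phi1 ep in up.
Qed.
End Assembly.

Section Main.
Variables (F : fieldType) (p q lam : F) (nu : {mset F}%mset).
Hypotheses (hp0 : p != 0) (hqI : ~ Iorbit p lam q).
Hypothesis Idisj : (Iplus p lam `&` Iminus p lam = set0)%classic.
Hypothesis hnu : thetaN (Iorbit p lam) nu.
Local Notation tnu := (mset_restrict (Iplus p lam) nu).

Lemma morphismD (A B : kalg F) (f : A -> B) : zmod_morphism f ->
  forall a b, f (a + b) = f a + f b.
Proof.
by move=> fB a b; have := fB (a + b) b; rewrite addrK => ->; rewrite subrK.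
Qed.

(** The two morphisms required by [assembly_morita] come from the universal
properties of the presentations. *)
Theorem vv_pos_morita n : morita_equivalent (vv_pos p n q nu) (klr_pos p n tnu).
Proof.
set W := vv_pos p n q nu; set R := klr_pos p n tnu.
pose gW (x : vv_gen n nu) : W := cls _ (TVar x).
pose gR (x : klr_gen n tnu) : R := cls _ (TVar x).
have relW : forall t v, vv_rel p q t v -> teval gW t = teval gW v := @presented_rel _ _ _.
have relWk t v (r : klr_rel p (val : theta_idx n.+1 nu -> n.+1.-tuple F)
    (fun l => TVar (VX nu l)) (fun k => TVar (VS nu k)) (fun i => TVar (VE i)) t v) :=
  relW _ _ (vv_klr q r).
have relR : forall t v, klr_rel p (val : klr_idx n.+1 tnu -> n.+1.-tuple F)
    (fun l => TVar (KX tnu l)) (fun k => TVar (KS tnu k)) (fun i => TVar (KE i)) t v ->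
    teval gR t = teval gR v := @presented_rel _ _ _.
have vvI : injective (val : theta_idx n.+1 nu -> n.+1.-tuple F) by exact: val_inj.
have vvP (j : theta_idx n.+1 nu) : theta_seq nu (val j) by exact: valP.
have klrI : injective (val : klr_idx n.+1 tnu -> n.+1.-tuple F) by exact: val_inj.
have klrP (j : klr_idx n.+1 tnu) : klr_seq tnu (val j) by exact: valP.
have LW := vv_presented_laws hqI hnu relW.
have EWout := idem_out (fun i => TVar (VE i)) gW vvP.
have EWsum := idem_sum1 vvI relWk.
have LR := klr_presented_laws klrI klrP (@klr_idx_of F p n lam nu) (@klr_swap F n tnu) relR.
have ERout := idem_out (fun i => TVar (KE i)) gR klrP.
have ERsum := idem_sum1 klrI relR.
set EW := vv_idem gW in LW.
set ER := idem _ _ gR in LR ERsum.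
have EWE i : EW (val i) = gW (VE i) by exact: idem_seq.
have ERE i : ER (val i) = gR (KE i) by exact: idem_seq.
pose fM (x : vv_gen n nu) : mx_alg R #|sgn n| := match x with
  | VX l => mX (fun l => gR (KX tnu l)) l
  | VS k => mS (fun k => gR (KS tnu k)) k
  | VE i => mE ER (val i)
  | VPi => mPi n R end.
have relM : forall t v, vv_rel p q t v -> teval fM t = teval fM v.
  apply: (vv_rel_of_laws hqI hnu _ _ _ _ (matrix_vv_laws hp0 Idisj LR ERout)) => //.
  exact (mE_sum Idisj hnu ERout ERsum).
have [Psi [[PsiB [_ PsiM] PsiC PsiX] _]] := presented_univ relM.
have cW := corner_laws lam LW EWout EWsum.
have cS := cut_klr_sum lam LW EWout EWsum.
pose cutW := cut (plus_idem_idem lam LW EWout EWsum).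
pose fC (x : klr_gen n tnu) := match x with
  | KX l => cutW (gW (VX nu l))
  | KS k => cutW (gW (VS nu k))
  | KE i => cutW (EW (val i)) end.
have relC : forall t v, klr_rel p (val : klr_idx n.+1 tnu -> n.+1.-tuple F)
    (fun l => TVar (KX tnu l)) (fun k => TVar (KS tnu k)) (fun i => TVar (KE i)) t v ->
    teval fC t = teval fC v.
  by apply: (klr_rel_of_laws _ _ _ klrI cW).
have [Phi [[PhiB [Phi1 PhiM] PhiC PhiX] _]] := presented_univ relC.
refine (@assembly_morita F p lam n nu hp0 Idisj hnu W (fun l => gW (VX nu l))
  (fun k => gW (VS nu k)) EW (gW (VPi n nu)) LW EWout EWsum _ R (fun l => gR (KX tnu l))
  (fun k => gR (KS tnu k)) ER ERout ERsum _ Psi (morphismD PsiB) PsiM PsiC _ _ _ _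
  Phi (morphismD PhiB) PhiM Phi1 PhiC _ _ _).
- move=> P PX PS PE PPi; apply: presented_ind => -[l|k|i|].
  + exact: PX.
  + exact: PS.
  + by have := PE i; rewrite EWE.
  + exact: PPi.
- move=> P PX PS PE; apply: presented_ind => -[l|k|i].
  + exact: PX.
  + exact: PS.
  + by have := PE i; rewrite ERE.
- by move=> l; rewrite [LHS]PsiX.
- by move=> k; rewrite [LHS]PsiX.
- by move=> i; rewrite EWE [LHS]PsiX.
- by rewrite [LHS]PsiX.
- by move=> l; rewrite [LHS]PhiX.
- by move=> k; rewrite [LHS]PhiX.
- by move=> i; rewrite ERE [LHS]PhiX.
Qed.
End Main.

Theorem theorem2p10 (F : fieldType) (p q lam : F) (nu : {mset F}%mset)
    (hchar : 2%N \notin [pchar F])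
    (hp0 : p != 0) (hq0 : q != 0) (hp1 : p != 1) (hpN1 : p != -1)
    (hpq : forall n : int, p != q ^ n) (hqp : forall n : int, q != p ^ n)
    (hlam : lam != 0)
    (hI1 : ~ Iorbit p lam 1) (hIN1 : ~ Iorbit p lam (-1))
    (hIdisj : (Iplus p lam `&` Iminus p lam = set0)%classic)
    (hpI : ~ Iorbit p lam p) (hqI : ~ Iorbit p lam q)
    (hnu : thetaN (Iorbit p lam) nu) :
  morita_equivalent (VV p q nu) (KLR p (mset_restrict (Iplus p lam) nu)).
Proof.
rewrite /VV /KLR (size_restrict hIdisj hnu).
by case: (size _) => [|n]; [exact: morita_refl | exact: vv_pos_morita].
Qed.
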